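(* Let $\mathcal D$ be a polyhedra system. Then there is a finite sequence of characteristic transforms $$\mathcal D\rightarrow\mathcal D_1\rightarrow\mathcal D_2\rightarrow\cdots\rightarrow\mathcal D_k$$ (each system being the characteristic transform of the preceding one centered in some stratum of the singular locus of the preceding one) such that $\mathrm{Sing}(\mathcal D_k)=\emptyset$.
   Context: Support fabrics. For a finite set $I$, $\mathcal P(I)$ denotes its power set. A support fabric is a pair $\mathcal F=(I,\mathcal H)$ with $I$ finite and $\mathcal H\subset\mathcal P(I)$ such that $J\in\mathcal H$ implies $\mathcal P(J)\subset\mathcal H$. Elements of $\mathcal H$ are called strata. Blow-up. Let $J\in\mathcal H$ be non-empty. Put $I'=I\cup\{\infty\}$ with $\infty\notin I$. Let $\mathcal H'_s=\{K\in\mathcal H: J\not\subset K\}$; for $K\in\mathcal H$ with $K\supset J$ let $\mathcal H'^K_\infty=\{(K\setminus J)\cup A\cup\{\infty\}: A\subsetneq J\}$; let $\mathcal H'_\infty=\bigcup_{K\in\mathcal H,K\supset J}\mathcal H'^K_\infty$ and $\mathcal H'=\mathcal H'_s\cup\mathcal H'_\infty$. The blow-up is the support fabric $\pi_J(\mathcal F)=(I',\mathcal H')$. The map $\pi_J^\#:\mathcal H'\to\mathcal H$ is defined by $\pi_J^\#(J')=J'$ if $J'\in\mathcal H'_s$ and $\pi_J^\#(J')=K$ if $J'\in\mathcal H'^K_\infty$. Polyhedra systems. For a finite set $J$ and $A\subset\mathbb R^J_{\ge0}$, let $[[A]]$ be the convex hull of $A+\mathbb R^J_{\ge0}$. For an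 integer $d\ge1$, a characteristic polyhedron with denominator $d$ is a set $\Delta=[[A]]\subset\mathbb R^J_{\ge0}$ with $A\subset\frac1d\mathbb Z^J_{\ge0}$; all polyhedra are assumed non-empty. A polyhedra system with denominator $d$ is $\mathcal D=(\mathcal F;\{\Delta_J\}_{J\in\mathcal H},d)$, where $\mathcal F=(I,\mathcal H)$ is a support fabric, each $\Delta_J\subset\mathbb R^J_{\ge0}$ is a characteristic polyhedron with denominator $d$, and $\Delta_{J_1}=\mathrm{pr}_{J_2,J_1}(\Delta_{J_2})$ whenever $J_1\subset J_2$ are in $\mathcal H$, with $\mathrm{pr}_{J_2,J_1}(\sigma)=\sigma|_{J_1}$. Singular locus. For $\Delta\subset\mathbb R^J_{\ge0}$ with $J\neq\emptyset$, $\delta(\Delta)=\min\{|\sigma|:\sigma\in\Delta\}$ with $|\sigma|=\sum_{j\in J}\sigma(j)$; for $J=\emptyset$ the convention is $\delta(\Delta)=-1$. $\mathrm{Sing}(\mathcal D)=\{J\in\mathcal H:\delta(\Delta_J)\ge1\}$. Characteristic transform. For $J\in\mathrm{Sing}(\mathcal D)$, $J'\in\mathcal H'_\infty$ and $K=\pi_J^\#(J')$, define $\lambda_{J'}:\mathbb R^K\to\mathbb R^{J'}$ by $\lambda_{J'}(\sigma)(j)=\sigma(j)$ for $j\ne\infty$ and $\lambda_{J'}(\sigma)(\infty)=\sum_{j\in J}\sigma(j)$. The characteristic transform of $\mathcal D$ centered in $J$ is the polyhedra system $\Lambda_J(\mathcal D)=(\pi_J(\mathcal F);\{\Delta'_{J'}\}_{J'\in\mathcal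 H'},d)$ with $\Delta'_{J'}=\Delta_{J'}$ if $J'\in\mathcal H'_s$, and $\Delta'_{J'}=[[\lambda_{J'}(\Delta_K)]]-e_{J',\infty}$ if $J'\in\mathcal H'_\infty$, $K=\pi_J^\#(J')$, where $e_{J',\infty}\in\mathbb R^{J'}$ is the standard basis vector of index $\infty$. Finite sequences of transforms may have length zero. *)

(* Defs.v *)
From HB Require Import structures.
From mathcomp Require Import all_boot all_order all_algebra.
From mathcomp Require Import interval_inference boolp classical_sets reals convex.

Set Implicit Arguments.
Unset Strict Implicit.
Unset Printing Implicit Defensive.
Import Order.TTheory GRing.Theory Num.Theory.

Local Open Scope ring_scope.
Local Open Scope classical_set_scope.

Record support_fabric := SupportFabric {
  vertices : finType;
  strata : {set {set vertices}};
  strata_down : forall J K : {set vertices},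
    J \in strata -> K \subset J -> K \in strata
}.

Section Blowup.
Context (I : finType).
Implicit Types (H : {set {set I}}) (J K : {set I}) (L : {set option I}).

(* The index set I' = I + {oo} is [option I], with oo = [None] and [i : I]
   seen in I' as [Some i]. *)
Definition strata_s H J : {set {set option I}} :=
  [set Some @: (K : {set I}) | K in H & ~~ (J \subset K)]%SET.

Definition strata_inf_over J K : {set {set option I}} :=
  [set None |: (Some @: ((K :\: J) :|: A)) | A : {set I} & A \proper J]%SET.

Definition strata_inf H J : {set {set option I}} :=
  (\bigcup_(K in H | J \subset K) strata_inf_over J K)%SET.

Definition blowup_strata H J : {set {set option I}} :=
  (strata_s H J :|: strata_inf H J)%SET.

(* K is recovered from L = (K \ J) + A + {oo} as (L \ {oo}) + J; the two
   lemmas [pi_sharp_s] and [pi_sharp_inf] are the defining clauses. *)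
Definition pi_sharp J L : {set I} :=
  if None \in L then ((Some @^-1: L) :|: J)%SET else (Some @^-1: L)%SET.

Lemma None_imset K : (None \in [set Some x | x in K]%SET) = false.
Proof. by apply/negbTE/imsetP => -[]. Qed.

Lemma preim_Some K : (Some @^-1: (Some @: K) = K)%SET.
Proof. by apply/setP => i; rewrite inE mem_imset//; exact: Some_inj. Qed.

Lemma pi_sharp_s J K : pi_sharp J (Some @: K)%SET = K.
Proof. by rewrite /pi_sharp None_imset preim_Some. Qed.

Lemma pi_sharp_inf J K L :
  J \subset K -> L \in strata_inf_over J K -> pi_sharp J L = K.
Proof.
move=> JK /imsetP[A]; rewrite !inE => /fintype.properP[AJ _] ->.
rewrite /pi_sharp !inE/=; apply/setP => i.
rewrite !inE/= mem_imset; last exact: Some_inj.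
rewrite !inE; have [iJ|iJ] := boolP (i \in J); first by rewrite orbT (fintype.subsetP JK).
have /negbTE -> : i \notin A by apply: contra iJ => /(fintype.subsetP AJ).
by rewrite !orbF.
Qed.

Lemma strata_sP H J L : reflect
  (exists K, [/\ K \in H, ~~ (J \subset K) & L = (Some @: K)%SET])
  (L \in strata_s H J).
Proof.
apply: (iffP imsetP) => [[K]|[K [KH JK ->]]].
  by rewrite !inE => /andP[KH JK] ->; exists K.
by exists K => //; rewrite !inE KH.
Qed.

Lemma strata_infP H J L : reflect
  (exists K (A : {set I}), [/\ K \in H, J \subset K, A \proper J &
     L = (None |: (Some @: ((K :\: J) :|: A)))%SET])
  (L \in strata_inf H J).
Proof.
apply: (iffP finset.bigcupP) => [[K /andP[KH JK] /imsetP[A]]|[K [A [KH JK AJ ->]]]].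
  by rewrite !inE => AJ ->; exists K, A.
by exists K; [rewrite KH|apply/imsetP; exists A => //; rewrite !inE].
Qed.

Lemma blowup_strata_down H J :
  (forall K1 K2 : {set I}, K1 \in H -> K2 \subset K1 -> K2 \in H) ->
  forall L1 L2 : {set option I},
  L1 \in blowup_strata H J -> L2 \subset L1 -> L2 \in blowup_strata H J.
Proof.
move=> Hdown L1 L2 /finset.setUP[/strata_sP[K [KH JK ->]]|] sL.
  apply/finset.setUP; left; apply/strata_sP; exists (Some @^-1: L2)%SET.
  have sLK : (Some @^-1: L2)%SET \subset K.
    by rewrite -[K]preim_Some preimsetS.
  split; [exact: Hdown KH _|by apply: contra JK => /fintype.subset_trans; apply|].
  apply/setP => -[i|]; last first.
    rewrite None_imset; apply/negbTE/negP => /(fintype.subsetP sL).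
    by rewrite None_imset.
  by rewrite mem_imset ?inE//; exact: Some_inj.
move: sL => /strata_infP[K [A [KH JK AJ ->]]] sL.
pose K2 := (Some @^-1: L2)%SET.
have sLK : K2 \subset ((K :\: J) :|: A)%SET.
  apply/fintype.subsetP => i iK2; have := fintype.subsetP sL (Some i).
  rewrite in_setU1 mem_imset; last exact: Some_inj.
  by apply; rewrite inE in iK2.
have sLK' : K2 \subset K.
  apply: fintype.subset_trans sLK _; rewrite finset.subUset finset.subsetDl/=.
  exact: fintype.subset_trans (proper_sub AJ) JK.
apply/finset.setUP; have [nL|nL] := boolP (None \in L2); [right|left].
  apply/strata_infP; exists (K2 :|: J)%SET, (K2 :&: J)%SET; split.
  - by apply: Hdown KH _; rewrite finset.subUset sLK'.
  - exact: finset.subsetUr.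
  - apply: fintype.sub_proper_trans AJ; apply/fintype.subsetP => i /finset.setIP[/(fintype.subsetP sLK)].
    by rewrite !inE => /orP[/andP[/negPf->]|].
  - apply/setP => -[i|]; rewrite !inE ?nL//= mem_imset; last exact: Some_inj.
    by rewrite !inE; case: (i \in J); case: (Some i \in L2).
apply/strata_sP; exists K2; split.
- exact: Hdown KH _.
- have /fintype.properP[_ [i iJ iA]] := AJ.
  apply/negP => /fintype.subsetP/(_ _ iJ)/(fintype.subsetP sLK).
  by rewrite !inE iJ (negbTE iA).
- apply/setP => -[i|]; first by rewrite mem_imset ?inE//; exact: Some_inj.
  by rewrite None_imset (negbTE nL).
Qed.

Lemma pi_sharp_strata H J L : L \in blowup_strata H J -> pi_sharp J L \in H.
Proof.
case/finset.setUP => [/strata_sP[K [KH JK ->]]|]; first by rewrite pi_sharp_s.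
case/finset.bigcupP => K /andP[KH JK] JK'.
by rewrite (pi_sharp_inf JK JK').
Qed.

Lemma pi_sharpS J (L1 L2 : {set option I}) :
  L1 \subset L2 -> pi_sharp J L1 \subset pi_sharp J L2.
Proof.
move=> KL; rewrite /pi_sharp.
have S : (Some @^-1: L1)%SET \subset (Some @^-1: L2)%SET by exact: preimsetS.
case: ifPn => nK; first by rewrite (fintype.subsetP KL)// finset.setSU.
by case: ifP => // _; apply: fintype.subset_trans S _; exact: finset.subsetUl.
Qed.

End Blowup.

(* Only meaningful for J a non-empty stratum; every J in [Sing] is one, by
   [Sing_strata] and [Sing_neq0]. *)
Definition blowup (F : support_fabric) (J : {set vertices F}) : support_fabric :=
  SupportFabric (blowup_strata_down (J := J) (@strata_down F)).

Section Polyhedra.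
Context (R : realType).

Definition convex_hull (V : lmodType R) (A : set V) : set V :=
  smallest (@convex_set R V) A.

(* R^J, for J a subset of the finite index type I. *)
Definition coord_space (I : finType) (J : {set I}) : lmodType R :=
  {ffun {i : I | i \in J} -> R^o}.

Section CoordSpace.
Context (I : finType).
Implicit Types J K : {set I}.

(* [coeff s i] is the coordinate s(i), extended by 0 to indices outside J. *)
Definition coeff J (s : coord_space J) (i : I) : R :=
  oapp (s : {ffun {i : I | i \in J} -> R^o}) 0 (insub i).

Definition vec J (f : I -> R) : coord_space J :=
  [ffun j : {i : I | i \in J} => f (val j)].

(* The projection pr_{K,J}; used for J \subset K. *)
Definition restr J K (s : coord_space K) : coord_space J := vec J (coeff s).

Definition weight J (s : coord_space J) : R := \sum_(i in J) coeff s i.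

Definition orthant J : set (coord_space J) :=
  [set s | forall i, i \in J -> 0 <= coeff s i].

Definition polyhull J (A : set (coord_space J)) : set (coord_space J) :=
  convex_hull [set s + t | s in A & t in @orthant J].

Definition lattice_points J (d : nat) : set (coord_space J) :=
  [set s | forall i, i \in J -> exists n : nat, coeff s i = n%:R / d%:R].

Definition char_polyhedron J (d : nat) (D : set (coord_space J)) : Prop :=
  D !=set0 /\ exists2 A, A `<=` lattice_points d & D = polyhull A.

(* For characteristic polyhedra the infimum is a minimum: [deltaP]. *)
Definition delta J (D : set (coord_space J)) : R :=
  if J == finset.set0 then -1 else inf [set weight s | s in D].

End CoordSpace.
End Polyhedra.
Arguments restr {R I} J {K} s.
Arguments vec {R I} J f.

(* The sets [polyhedron J] for J outside the strata are irrelevant. *)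
Record polyhedra_system (R : realType) := PolyhedraSystem {
  fabric : support_fabric;
  denom : nat;
  polyhedron : forall J : {set vertices fabric}, set (coord_space R J);
  denom_gt0 : (0 < denom)%N;
  polyhedron_char : forall J : {set vertices fabric},
    J \in strata fabric -> char_polyhedron denom (@polyhedron J);
  polyhedron_restr : forall J1 J2 : {set vertices fabric},
    J1 \in strata fabric -> J2 \in strata fabric -> J1 \subset J2 ->
    @polyhedron J1 = [set restr J1 s | s in @polyhedron J2]
}.
Arguments polyhedron {R} p J.

Definition Sing (R : realType) (D : polyhedra_system R) :
    {set {set vertices (fabric D)}} :=
  [set J in strata (fabric D) | 1 <= delta (polyhedron D J)]%SET.

Section TransformData.
Context (R : realType) (I : finType).
Implicit Types (J K : {set I}) (L : {set option I}).

Definition lambda_map J K L (s : coord_space R K) : coord_space R L :=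
  vec L (fun j => if j is Some i then coeff s i else \sum_(i in J) coeff s i).

(* The identification of R^K with R^(Some @: K). *)
Definition relabel K L (s : coord_space R K) : coord_space R L :=
  vec L (fun j => if j is Some i then coeff s i else 0).

Definition e_inf L : coord_space R L := vec L (fun j => (j == None)%:R).

Definition transform_polyhedron (P : forall K : {set I}, set (coord_space R K))
    J L : set (coord_space R L) :=
  if None \in L then
    [set s - e_inf L |
       s in polyhull [set lambda_map J L t | t in P (pi_sharp J L)]]
  else [set relabel L t | t in P (pi_sharp J L)].

End TransformData.
Arguments transform_polyhedron {R I} P J L.

Section ConvexHullTheory.
Context (R : realType).

Lemma sub_convex_hull (V : lmodType R) (A : set V) : A `<=` convex_hull A.
Proof. exact: sub_gen_smallest. Qed.

Lemma convex_hull_sub (V : lmodType R) (A B : set V) :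
  @convex_set R V B -> A `<=` B -> convex_hull A `<=` B.
Proof. exact: smallest_sub. Qed.

Lemma convex_hull_convex (V : lmodType R) (A : set V) :
  @convex_set R V (convex_hull A).
Proof.
move=> x y l; rewrite !inE => xA yA B [cB AB].
by apply/set_mem/cB; apply/mem_set; [apply: xA|apply: yA].
Qed.

Definition affine (V W : lmodType R) (f : V -> W) :=
  forall (t : R) x y, f (t *: x + (1 - t) *: y) = t *: f x + (1 - t) *: f y.

Lemma preimage_convex (V W : lmodType R) (f : V -> W) (B : set W) :
  affine f -> @convex_set R W B -> @convex_set R V (f @^-1` B).
Proof.
move=> aff cB x y l; rewrite !inE /preimage/= => xB yB.
have := cB (f x) (f y) l (mem_set xB) (mem_set yB); rewrite inE.
by rewrite /conv/= /unstable.onem aff.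
Qed.

Lemma image_convex (V W : lmodType R) (f : V -> W) (A : set V) :
  affine f -> @convex_set R V A -> @convex_set R W (f @` A).
Proof.
move=> aff cA u v l; rewrite !inE => -[x xA <-] [y yA <-].
have := cA x y l (mem_set xA) (mem_set yA); rewrite inE => xyA.
eexists; first exact: xyA.
by rewrite /conv/= /unstable.onem aff.
Qed.

Lemma convex_hull_image (V W : lmodType R) (f : V -> W) (A : set V) :
  affine f -> f @` convex_hull A = convex_hull (f @` A).
Proof.
move=> aff; apply/seteqP; split.
  suff H : convex_hull A `<=` f @^-1` convex_hull (f @` A).
    by move=> _ [x xA <-]; exact: H.
  apply: convex_hull_sub.
    exact: preimage_convex aff (@convex_hull_convex _ _).
  by move=> x xA; apply: sub_convex_hull; exists x.
apply: convex_hull_sub.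
  exact: image_convex aff (@convex_hull_convex _ _).
by move=> _ [x xA <-]; exists x => //; exact: sub_convex_hull.
Qed.

Lemma linear_affine (V W : lmodType R) (f : V -> W) : linear f -> affine f.
Proof.
move=> lf t x y.
have f0 : f 0 = 0.
  by have := lf (-1) 0 0; rewrite !scaleN1r !addNr.
rewrite lf; congr (_ + _).
by have := lf (1 - t) y 0; rewrite f0 !addr0.
Qed.

Lemma translate_affine (V : lmodType R) (e : V) : affine (fun x => x + e).
Proof.
move=> t x y; rewrite !scalerDr addrACA -scalerDl.
by rewrite subrKC scale1r.
Qed.

End ConvexHullTheory.

Section CoordTheory.
Context (R : realType) (I : finType).
Implicit Types (J K : {set I}) (L : {set option I}).

Lemma coeffE J (s : coord_space R J) (j : {i : I | i \in J}) :
  coeff s (val j) = (s : {ffun {i : I | i \in J} -> R^o}) j.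
Proof. by rewrite /coeff valK. Qed.

Lemma coeff_out J (s : coord_space R J) i : i \notin J -> coeff s i = 0.
Proof. by move=> iJ; rewrite /coeff insubN. Qed.

Lemma coeffP J (s t : coord_space R J) :
  (forall i, i \in J -> coeff s i = coeff t i) -> s = t.
Proof. by move=> st; apply/ffunP => j; rewrite -!coeffE; apply/st/valP. Qed.

Lemma coeff_vec J (f : I -> R) i :
  coeff (vec J f) i = if i \in J then f i else 0.
Proof.
rewrite /coeff; case: insubP => [j -> <-|/negPf-> //].
by rewrite /= ffunE.
Qed.

Lemma coeffD J (s t : coord_space R J) i :
  coeff (s + t) i = coeff s i + coeff t i.
Proof. by rewrite /coeff; case: insub => [j|]/=; rewrite ?addr0// ffunE. Qed.

Lemma coeffZ J (a : R) (s : coord_space R J) i : coeff (a *: s) i = a * coeff s i.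
Proof. by rewrite /coeff; case: insub => [j|]/=; rewrite ?mulr0// ffunE. Qed.

Lemma coeffN J (s : coord_space R J) i : coeff (- s) i = - coeff s i.
Proof. by rewrite -scaleN1r coeffZ mulN1r. Qed.

Lemma coeff0 J i : coeff (0 : coord_space R J) i = 0.
Proof. by rewrite -(scale0r 0) coeffZ mul0r. Qed.

Lemma coeff_restr J K (s : coord_space R K) i :
  coeff (restr J s) i = if i \in J then coeff s i else 0.
Proof. exact: coeff_vec. Qed.

Lemma restr_linear J K : linear (@restr R I J K).
Proof.
move=> a s t; apply: coeffP => i iJ.
by rewrite coeffD coeffZ !coeff_restr iJ coeffD coeffZ.
Qed.

Lemma orthantD J (s t : coord_space R J) :
  orthant s -> orthant t -> orthant (s + t).
Proof. by move=> s0 t0 i iJ; rewrite coeffD addr_ge0 ?s0 ?t0. Qed.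

Lemma orthant0 J : orthant (0 : coord_space R J).
Proof. by move=> i _; rewrite coeff0. Qed.

Lemma sub_polyhull J (A : set (coord_space R J)) : A `<=` polyhull A.
Proof.
move=> s As; apply: sub_convex_hull; exists s => //; exists 0; last exact: addr0.
exact: orthant0.
Qed.

Lemma polyhull_convex J (A : set (coord_space R J)) :
  @convex_set R (coord_space R J) (polyhull A).
Proof. exact: convex_hull_convex. Qed.

Lemma polyhullD J (A : set (coord_space R J)) s t :
  polyhull A s -> orthant t -> polyhull A (s + t).
Proof.
move=> As t0; suff H : polyhull A `<=` (fun x => x + t) @^-1` polyhull A.
  exact: H.
apply: convex_hull_sub.
  apply: preimage_convex (@translate_affine _ _ t) _; exact: polyhull_convex.
move=> _ [a Aa] [o o0] <-; apply: sub_convex_hull.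
exists a => //; exists (o + t); last by rewrite addrA.
exact: orthantD.
Qed.

Lemma polyhull_sub J (A B : set (coord_space R J)) :
  A `<=` polyhull B -> polyhull A `<=` polyhull B.
Proof.
move=> AB; apply: convex_hull_sub; first exact: polyhull_convex.
by move=> _ [a Aa] [o o0] <-; apply: polyhullD => //; exact: AB.
Qed.

Lemma polyhull_id J (A : set (coord_space R J)) :
  polyhull (polyhull A) = polyhull A.
Proof. by apply/seteqP; split; [exact: polyhull_sub|exact: sub_polyhull]. Qed.

Lemma polyhull_translate J (A : set (coord_space R J)) e :
  [set s - e | s in polyhull A] = polyhull [set s - e | s in A].
Proof.
rewrite [LHS](convex_hull_image _ (@translate_affine _ _ (- e))).
congr convex_hull; apply/seteqP; split.
  move=> _ [_ [a Aa [o o0 <-]] <-]; exists (a - e); first by exists a.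
  by exists o => //; rewrite addrAC.
move=> _ [_ [a Aa <-] [o o0 <-]]; exists (a + o); last by rewrite addrAC.
by exists a => //; exists o.
Qed.

Lemma weight_affine J : affine (W := R^o) (@weight R I J).
Proof.
move=> t x y; rewrite /weight !scaler_sumr -big_split/=.
by apply: eq_bigr => i _; rewrite coeffD !coeffZ.
Qed.

Lemma halfspace_convex J (c : R) :
  @convex_set R (coord_space R J) [set s | c <= weight s].
Proof.
move=> x y l; rewrite !inE/= => xc yc.
have -> : weight (convex.conv l x y) = l%:num * weight x + (1 - l%:num) * weight y.
  by rewrite /convex.conv/= /unstable.onem weight_affine.
rewrite -[c]mul1r -[X in X * c](subrKC l%:num) mulrDl.
by rewrite lerD// ler_wpM2l// subr_ge0.
Qed.

Lemma polyhull_weight J (A : set (coord_space R J)) c :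
  (forall s, A s -> c <= weight s) -> forall s, polyhull A s -> c <= weight s.
Proof.
move=> Ac; apply: convex_hull_sub; first exact: halfspace_convex.
move=> _ [a Aa [o o0 <-]] /=.
rewrite /weight (eq_bigr _ (fun i _ => coeffD a o i)) big_split/=.
by apply: ler_wpDr; [exact: sumr_ge0|exact: Ac].
Qed.

End CoordTheory.

Section PolyhullImage.
Context (R : realType) (I I' : finType) (J : {set I}) (L : {set I'}).
Context (f : coord_space R J -> coord_space R L) (fl : linear f).

Lemma polyhull_image (A : set (coord_space R J)) :
  f @` @orthant R I J = @orthant R I' L -> f @` polyhull A = polyhull (f @` A).
Proof.
have fD s t : f (s + t) = f s + f t by have := fl 1 s t; rewrite !scale1r.
move=> fO; rewrite /polyhull (convex_hull_image _ (linear_affine fl)).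
congr convex_hull; apply/seteqP; split.
  move=> _ [_ [a Aa [o o0 <-]] <-]; exists (f a); first by exists a.
  by exists (f o); [rewrite -fO; exists o|rewrite fD].
move=> u [_ [a Aa <-]]; rewrite -fO => -[_ [o o0 <-] <-].
by exists (a + o); [exists a => //; exists o|rewrite fD].
Qed.

Lemma polyhull_image_hull (A : set (coord_space R J)) :
  f @` @orthant R I J `<=` @orthant R I' L ->
  polyhull (f @` polyhull A) = polyhull (f @` A).
Proof.
have fD s t : f (s + t) = f s + f t by have := fl 1 s t; rewrite !scale1r.
move=> fO; apply/seteqP; split; apply: polyhull_sub; last first.
  by move=> _ [a Aa <-]; apply: sub_polyhull; exists a => //; exact: sub_polyhull.
suff H : polyhull A `<=` f @^-1` polyhull (f @` A).
  by move=> _ [a Aa <-]; exact: H.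
apply: convex_hull_sub.
  apply: preimage_convex (linear_affine fl) _; exact: polyhull_convex.
move=> _ [a Aa [o o0 <-]]; rewrite /preimage/= fD; apply: polyhullD.
  by apply: sub_polyhull; exists a.
by apply: fO; exists o.
Qed.

End PolyhullImage.

Section TransformTheory.
Context (R : realType) (I : finType).
Implicit Types (J K : {set I}) (L : {set option I}).

Lemma restr_orthant J K : J \subset K ->
  restr J @` @orthant R I K = @orthant R I J.
Proof.
move=> JK; apply/seteqP; split => [_ [s s0 <-] i iJ|s s0].
  by rewrite coeff_restr iJ; apply/s0/(fintype.subsetP JK).
exists (restr K s) => [i iK|].
  rewrite coeff_restr iK; have [iJ|iJ] := boolP (i \in J); first exact: s0.
  by rewrite coeff_out.
by apply: coeffP => i iJ; rewrite !coeff_restr iJ (fintype.subsetP JK).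
Qed.

Lemma polyhull_restr J K (A : set (coord_space R K)) : J \subset K ->
  restr J @` polyhull A = polyhull (restr J @` A).
Proof.
by move=> JK; apply: polyhull_image; [exact: restr_linear|exact: restr_orthant].
Qed.

Lemma lambda_linear J K L : linear (@lambda_map R I J K L).
Proof.
move=> a s t; apply: coeffP => -[i|] iJ;
  rewrite coeffD coeffZ !coeff_vec iJ ?coeffD ?coeffZ//.
rewrite mulr_sumr -big_split/=; apply: eq_bigr => i _.
by rewrite coeffD coeffZ.
Qed.

Lemma lambda_orthant J K L : J \subset K -> (Some @^-1: L)%SET \subset K ->
  @lambda_map R I J K L @` @orthant R I K `<=` @orthant R _ L.
Proof.
move=> JK JK' _ [s s0 <-] [i|] iJ; rewrite coeff_vec iJ.
  by apply/s0/(fintype.subsetP JK'); rewrite inE.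
by apply: sumr_ge0 => i iJ'; apply/s0/(fintype.subsetP JK).
Qed.

Lemma relabel_linear K L : linear (@relabel R I K L).
Proof.
by move=> a s t; apply: coeffP => -[i|] iJ;
  rewrite coeffD coeffZ !coeff_vec iJ ?coeffD ?coeffZ// mulr0 addr0.
Qed.

Lemma relabel_orthant L : None \notin L ->
  @relabel R I (Some @^-1: L)%SET L @` @orthant R I _ = @orthant R _ L.
Proof.
move=> nJ; apply/seteqP; split => [_ [s s0 <-]|s s0].
  by move=> [i|] iJ; rewrite coeff_vec iJ//; apply: s0; rewrite inE.
exists (vec _ (fun i => coeff s (Some i))).
  by move=> i; rewrite inE => iJ; rewrite coeff_vec inE iJ; apply: s0.
apply: coeffP => -[i|] iJ; last by rewrite iJ in nJ.
by rewrite !coeff_vec iJ inE iJ.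
Qed.

Lemma polyhull_relabel L (A : set (coord_space R (Some @^-1: L)%SET)) :
  None \notin L ->
  relabel L @` polyhull A = polyhull (relabel L @` A).
Proof.
move=> nJ; apply: polyhull_image; first exact: relabel_linear.
exact: relabel_orthant.
Qed.

Lemma char_polyhullK K d (P : set (coord_space R K)) :
  char_polyhedron d P -> polyhull P = P.
Proof. by case=> _ [A _ ->]; exact: polyhull_id. Qed.

Lemma inf_weight_le J d (P : set (coord_space R J)) (s : coord_space R J) :
  char_polyhedron d P -> P s -> inf [set weight t | t in P] <= weight s.
Proof.
case=> _ [A Ad ->] Ps; apply: ge_inf; last by exists s.
exists 0 => _ [t Pt <-]; apply: polyhull_weight Pt => u /Ad ud.
by apply: sumr_ge0 => i iJ; have [n ->] := ud i iJ; rewrite divr_ge0.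
Qed.

Lemma lattice_weight J d (s : coord_space R J) :
  lattice_points d s -> exists n : nat, weight s = n%:R / d%:R.
Proof.
move=> sd.
have H i : exists n : nat, i \in J -> coeff s i = n%:R / d%:R.
  by case: (boolP (i \in J)) => [/sd[n ->]|_]; [exists n|exists 0%N].
have [n nP] := choice H.
exists (\sum_(i in J) n i)%N; rewrite natr_sum mulr_suml.
exact: eq_bigr.
Qed.

Lemma deltaP J d (P : set (coord_space R J)) :
  (0 < d)%N -> char_polyhedron d P -> J != finset.set0 ->
  (exists2 s, P s & weight s = delta P) /\ forall s, P s -> delta P <= weight s.
Proof.
move=> d0 cP J0; rewrite /delta (negbTE J0); split; last first.
  by move=> s; exact: inf_weight_le cP.
have d0' : 0 < d%:R :> R by rewrite ltr0n.
have [[p Pp] [A Ad PA]] := cP.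
pose Q := fun n : nat => `[< exists2 s, A s & weight s = n%:R / d%:R >].
have exQ : exists n, Q n.
  apply: contrapT => nQ; have A0 s : ~ A s.
    move=> As; have [n sn] := lattice_weight (Ad _ As).
    by apply: nQ; exists n; apply/asboolP; exists s.
  have: polyhull A `<=` set0.
    apply: convex_hull_sub; first by move=> x y l; rewrite inE.
    by move=> u [a /A0].
  by move/(_ p); rewrite -PA; apply.
case: (ex_minnP exQ) => m /asboolP[s As sm] mmin.
have Ps : P s by rewrite PA; exact: sub_polyhull.
exists s => //; apply/eqP; rewrite eq_le; apply/andP; split; last first.
  exact: inf_weight_le cP Ps.
apply: lb_le_inf; first by exists (weight s), s.
move=> _ [t Pt <-]; rewrite PA in Pt; apply: polyhull_weight Pt => u Au.
have [n un] := lattice_weight (Ad _ Au).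
rewrite sm un ler_pM2r ?invr_gt0// ler_nat; apply: mmin.
by apply/asboolP; exists u.
Qed.

End TransformTheory.

Section CharTransform.
Context (R : realType) (D : polyhedra_system R) (J : {set vertices (fabric D)}).
Context (JS : J \in Sing D).
Let F := fabric D.
Local Notation P := (polyhedron D).
Implicit Types (K : {set vertices F}) (L : {set option (vertices F)}).

Lemma Sing_strata : J \in strata F.
Proof. by move: JS; rewrite inE => /andP[]. Qed.

Lemma Sing_neq0 : J != finset.set0.
Proof.
move: JS; rewrite inE => /andP[_]; rewrite /delta; case: ifP => // _.
by rewrite leNgt (lt_trans (ltrN10 R) ltr01).
Qed.

Lemma Sing_weight K (s : coord_space R K) : K \in strata F -> J \subset K -> P K s ->
  1 <= \sum_(i in J) coeff s i.
Proof.
move=> KH JK Ps; have := JS; rewrite inE => /andP[JH J1].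
have [_ /(_ (restr J s))] :=
  deltaP (denom_gt0 D) (polyhedron_char JH) Sing_neq0.
have -> : weight (restr J s) = \sum_(i in J) coeff s i.
  by apply: eq_bigr => i iJ; rewrite coeff_restr iJ.
move=> H; apply: le_trans J1 _; apply: H.
by rewrite (polyhedron_restr JH KH JK); exists s.
Qed.

Lemma transform_char L : L \in strata (blowup J) ->
  char_polyhedron (denom D) (transform_polyhedron P J L).
Proof.
move=> LH; have KH := pi_sharp_strata LH.
rewrite /transform_polyhedron; move: KH; rewrite /pi_sharp.
case: ifPn => nJ KH.
  set K := (_ :|: _)%SET in KH *.
  have JK : J \subset K by exact: finset.subsetUr.
  have [[p Pp] [A Ad PA]] := polyhedron_char KH.
  split.
    exists (lambda_map J L p - e_inf R L), (lambda_map J L p) => //.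
    by apply: sub_polyhull; exists p.
  have AP : A `<=` P K by move=> a Aa; rewrite PA; exact: sub_polyhull.
  exists [set s - e_inf R L | s in [set lambda_map J L t | t in A]]; last first.
    rewrite PA polyhull_image_hull; first exact: polyhull_translate.
      exact: lambda_linear.
    by apply: lambda_orthant => //; exact: finset.subsetUl.
  have d0 : (denom D)%:R != 0 :> R by rewrite pnatr_eq0 -lt0n denom_gt0.
  move=> _ [_ [a Aa <-] <-] [i|] iJ; rewrite coeffD coeffN !coeff_vec iJ/=.
    by rewrite subr0; apply: Ad => //; rewrite !inE iJ.
  have ge1 := Sing_weight KH JK (AP _ Aa).
  have aJ : lattice_points (denom D) (restr J a).
    move=> i iJ'; rewrite coeff_restr iJ'; apply: Ad => //.
    exact: (fintype.subsetP JK).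
  have [n an] := lattice_weight aJ.
  have {}an : \sum_(i in J) coeff a i = n%:R / (denom D)%:R.
    by rewrite -an; apply: eq_bigr => i iJ'; rewrite coeff_restr iJ'.
  exists (n - denom D)%N; rewrite an natrB.
    by rewrite mulrBl divff.
  move: ge1; rewrite an ler_pdivlMr ?mul1r ?ler_nat//.
  by rewrite ltr0n denom_gt0.
have [[p Pp] [A Ad PA]] := polyhedron_char KH.
split; first by exists (relabel L p), p.
exists [set relabel L t | t in A]; last by rewrite PA polyhull_relabel.
move=> _ [a Aa <-] [i|] iJ; last by rewrite iJ in nJ.
by rewrite coeff_vec iJ; apply: Ad => //; rewrite inE.
Qed.

Lemma transform_restr L1 L2 :
  L1 \in strata (blowup J) -> L2 \in strata (blowup J) -> L1 \subset L2 ->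
  transform_polyhedron P J L1 =
  [set restr L1 s | s in transform_polyhedron P J L2].
Proof.
move=> H1 H2 S12.
have K1H := pi_sharp_strata H1; have K2H := pi_sharp_strata H2.
have K12 := pi_sharpS J S12.
have := polyhedron_restr K1H K2H K12 => P12.
have cP1 : char_polyhedron (denom D) (P (pi_sharp J L1)) by exact: polyhedron_char.
have LK L : (Some @^-1: L)%SET \subset pi_sharp J L.
  by rewrite /pi_sharp; case: ifP => // _; exact: finset.subsetUl.
rewrite {2}/transform_polyhedron.
have [n2|n2] := boolP (None \in L2); last first.
  have n1 : None \notin L1 by apply: contra n2; apply/fintype.subsetP.
  rewrite /transform_polyhedron (negbTE n1) P12 !image_comp.
  apply: eq_imagel => s Ps; apply: coeffP => -[i|] iL /=; last first.
    by rewrite iL in n1.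
  rewrite !coeff_vec iL (fintype.subsetP S12)//.
  by rewrite (fintype.subsetP (LK L1)) ?inE.
have restrD (s t : coord_space R L2) : restr L1 (s - t) = restr L1 s - restr L1 t.
  by apply: coeffP => j jL; rewrite coeffD coeffN !coeff_restr jL coeffD coeffN.
have -> : [set restr L1 s | s in [set s - e_inf R L2 | s in
      polyhull [set lambda_map J L2 t | t in P (pi_sharp J L2)]]] =
    [set s - restr L1 (e_inf R L2) | s in
      polyhull [set restr L1 (lambda_map J L2 t) | t in P (pi_sharp J L2)]].
  have -> : [set restr L1 (lambda_map J L2 t) | t in P (pi_sharp J L2)] =
      restr L1 @` [set lambda_map J L2 t | t in P (pi_sharp J L2)].
    by rewrite image_comp.
  rewrite -polyhull_restr// !image_comp.
  by apply: eq_imagel => s _ /=; rewrite restrD.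
have [n1|n1] := boolP (None \in L1).
  have JK : J \subset pi_sharp J L1 by rewrite /pi_sharp n1; exact: finset.subsetUr.
  rewrite /transform_polyhedron n1 P12 image_comp.
  have -> : restr L1 (e_inf R L2) = e_inf R L1.
    by apply: coeffP => j jL; rewrite !coeff_vec jL (fintype.subsetP S12).
  congr image; congr polyhull; apply: eq_imagel => s _.
  apply: coeffP => -[i|] iL /=; rewrite !coeff_vec iL (fintype.subsetP S12)//.
    by rewrite (fintype.subsetP (LK L1)) ?inE.
  by apply: eq_bigr => i iJ; rewrite coeff_restr (fintype.subsetP JK).
have -> : restr L1 (e_inf R L2) = 0.
  apply: coeffP => -[i|] iL; last by rewrite iL in n1.
  by rewrite coeff0 !coeff_vec iL (fintype.subsetP S12).
have -> : [set restr L1 (lambda_map J L2 t) | t in P (pi_sharp J L2)] =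
    [set relabel L1 t | t in P (pi_sharp J L1)].
  rewrite P12 image_comp; apply: eq_imagel => s _; apply: coeffP => -[i|] iL /=.
    rewrite !coeff_vec iL (fintype.subsetP S12)//.
    by rewrite (fintype.subsetP (LK L1)) ?inE.
  by rewrite iL in n1.
have cT := transform_char H1.
rewrite /transform_polyhedron (negbTE n1) in cT *.
rewrite (char_polyhullK cT).
by rewrite -[LHS]image_id; apply: eq_imagel => s _; rewrite subr0.
Qed.

Definition char_transform : polyhedra_system R :=
  @PolyhedraSystem R (blowup J) (denom D) (transform_polyhedron P J)
    (denom_gt0 D) transform_char transform_restr.

End CharTransform.

(* Main.v *)
Require Import Defs.
From mathcomp Require Import all_boot all_order all_algebra reals.
From mathcomp Require Import boolp interval_inference ring lra zify.
From mathcomp Require classical_sets convex.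

(* Convexity plays no role: a system is a family of point sets P K, one for each
   stratum K, and K is singular when every point of P K has mass at least 1.
   Resolvability is proved by induction on the maximal cardinality of a stratum.

   Assume first that every singular K carries points of mass exactly 1, and let the
   contact set T(K) be the union of their supports.  A blow-up never shrinks contact
   sets: T(K) embeds into T(L) for every singular L over a singular K.  Choose a
   contact set T of minimal cardinality and a vertex j in T.  Projecting from j, that is
   s |-> s / (1 - s j), turns the strata through j into a system on the link of j,
   whose blow-ups are those of the original system with centers through j.  By
   induction it can be resolved; no singular stratum contains j any more, so T has
   disappeared while no new contact set of that cardinality was created.

   In general, write the points as s = M + N with a fixed monomial part M <= s, and let
   mu be the largest minimal mass of N on a singular stratum.  The system
   P + (P - M) / mu has only minimal masses at most 1, so it is resolved by the
   first case, and the same blow-ups make mu drop.  For mu = 0 the system is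
   governed by M alone and the blow-up of minimal centers terminates. *)

Set Implicit Arguments.
Unset Strict Implicit.
Unset Printing Implicit Defensive.
Import Order.TTheory GRing.Theory Num.Theory.
Local Open Scope ring_scope.

(** * Strata of a blow-up *)

Section BlowupStrata.
Context (I : finType).
Implicit Types (H : {set {set I}}) (J K : {set I}) (L : {set option I}).

Lemma pi_sharp_sup J L : Some @^-1: L \subset pi_sharp J L.
Proof. by rewrite /pi_sharp; case: ifP => // _; exact: subsetUl. Qed.

Lemma pi_sharp_center J L : None \in L -> J \subset pi_sharp J L.
Proof. by rewrite /pi_sharp => ->; exact: subsetUr. Qed.

Lemma imset_preim_Some L : None \notin L -> Some @: (Some @^-1: L) = L.
Proof.
move=> nL; apply/setP => -[i|]; first by rewrite mem_imset ?inE//; exact: Some_inj.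
by rewrite None_imset (negbTE nL).
Qed.

(** For strata through infinity and for the others alike, the part of [J] left in [L] must be a
    proper subset of [J]; this gives one criterion for both kinds. *)
Lemma in_blowup_strata H J L :
  (L \in blowup_strata H J) =
  (pi_sharp J L \in H) && ~~ (J \subset Some @^-1: L).
Proof.
apply/setUP/andP => [[/strata_sP[K [KH JK ->]]|]|[]].
- by rewrite pi_sharp_s preim_Some.
- move=> /strata_infP[K [A [KH JK AJ LE]]].
  have -> : pi_sharp J L = K.
    apply: pi_sharp_inf => //; apply/imsetP; exists A => //.
    by rewrite inE.
  split=> //; have /properP[_ [i iJ iA]] := AJ.
  apply/negP => /subsetP/(_ _ iJ); rewrite LE !inE/= mem_imset; last exact: Some_inj.
  by rewrite !inE iJ (negbTE iA).
rewrite /pi_sharp; case: ifPn => nL KH JL; [right|left].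
- apply/strata_infP; exists (Some @^-1: L :|: J), (Some @^-1: L :&: J); split=> //.
  + exact: subsetUr.
  + rewrite properE subsetIr/=; apply: contra JL => /subset_trans; apply.
    exact: subsetIl.
  apply/setP => -[i|]; rewrite !inE ?nL//= mem_imset; last exact: Some_inj.
  by rewrite !inE; case: (i \in J); case: (Some i \in L).
- apply/strata_sP; exists (Some @^-1: L); split=> //.
  by rewrite imset_preim_Some.
Qed.

Lemma card_option_le L : (#|L| <= #|Some @^-1: L|.+1)%N.
Proof.
have LS : L \subset None |: [set Some i | i in Some @^-1: L].
  apply/subsetP => -[i|] iL; rewrite !inE//= mem_imset ?inE//; exact: Some_inj.
apply: leq_trans (subset_leq_card LS) _; rewrite cardsU1 card_imset; last exact: Some_inj.
by rewrite -add1n leq_add2r leq_b1.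
Qed.

(** Passing through infinity adds one element, but at least one vertex of [J] is lost. *)
Lemma card_blowup_strata H J L n :
  {in H, forall K : {set I}, #|K| <= n}%N -> L \in blowup_strata H J -> (#|L| <= n)%N.
Proof.
move=> Hn; rewrite in_blowup_strata => /andP[/Hn KH JL].
have [nL|nL] := boolP (None \in L).
  apply: leq_trans (card_option_le L) (leq_trans _ KH).
  apply: proper_card; rewrite properE pi_sharp_sup/=.
  by apply: contra JL; apply: subset_trans; exact: pi_sharp_center.
move: KH; rewrite /pi_sharp (negbTE nL); apply: leq_trans.
by rewrite -{1}(imset_preim_Some nL) card_imset//; exact: Some_inj.
Qed.

Lemma big_option (T : Type) (idx : T) (op : Monoid.com_law idx) L (f : option I -> T) :
  \big[op/idx]_(o in L) f o =
  op (\big[op/idx]_(i in Some @^-1: L) f (Some i)) (if None \in L then f None else idx).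
Proof.
rewrite (bigID (pred1 None))/= Monoid.mulmC; congr (op _ _).
  rewrite -(big_imset f (in2W (@Some_inj _)))/=; apply: eq_bigl => -[i|] /=.
    by rewrite andbT mem_imset ?inE//; exact: Some_inj.
  by rewrite andbF None_imset.
have [nL|nL] := boolP (None \in L); last first.
  by apply: big1 => o /andP[oL /eqP oN]; rewrite -oN oL in nL.
by rewrite (big_pred1 None)// => o /=; case: eqP => [->|]; rewrite ?nL ?andbF.
Qed.

End BlowupStrata.

(** * Point families and their transforms *)

Section Families.
Context (R : realType).

Definition mass (I : finType) (K : {set I}) (s : I -> R) : R := \sum_(i in K) s i.

(* A family of point sets, one for each stratum; the values of a point of
   [P K] outside [K] are irrelevant, and no convexity is required. *)
Definition point_family (I : finType) := {set I} -> (I -> R) -> Prop.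

(** Combines [lambda_map] and the translation by [- e_inf] in one formula. *)
Definition blow (I : finType) (J : {set I}) (s : I -> R) (o : option I) : R :=
  if o is Some i then s i else mass J s - 1.

Definition transform (I : finType) (J : {set I}) (P : point_family I) : point_family (option I) :=
  fun L s' => exists2 s, P (pi_sharp J L) s & s' = blow J s.

Definition singular (I : finType) (H : {set {set I}}) (P : point_family I) (J : {set I}) :=
  J \in H /\ forall s, P J s -> 1 <= mass J s.

Inductive resolvable : forall I : finType, {set {set I}} -> point_family I -> Prop :=
| resolvable_nil (I : finType) (H : {set {set I}}) (P : point_family I) :
    (forall K, ~ singular H P K) -> resolvable H P
| resolvable_step (I : finType) (H : {set {set I}}) (P : point_family I) (J : {set I}) :
    singular H P J -> resolvable (blowup_strata H J) (transform J P) ->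
    resolvable H P.

Definition lattice (d : nat) (x : R) := exists n : nat, x = n%:R / d%:R.

(* [sys_disc] is what remains of the denominator: on every stratum, linear
   forms with natural coefficients attain their minimum at points of the
   lattice of mesh 1/d. *)
Record is_system (I : finType) (H : {set {set I}}) (P : point_family I) (d : nat) : Prop := {
  sys_d : (0 < d)%N;
  sys_down : forall J K : {set I}, K \in H -> J \subset K -> J \in H;
  sys_ne : forall K, K \in H -> exists s, P K s;
  sys_ge0 : forall K s, K \in H -> P K s -> {in K, forall i, 0 <= s i};
  sys_restr : forall (J K : {set I}) s, K \in H -> J \subset K -> P K s ->
    exists2 t, P J t & {in J, t =1 s};
  sys_lift : forall (J K : {set I}) t, K \in H -> J \subset K -> P J t ->
    exists2 s, P K s & {in J, s =1 t};
  sys_disc : forall K s (w : I -> nat), K \in H -> P K s ->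
    exists2 t, P K t & {in K, forall i, lattice d (t i)} /\
      mass K (fun i => t i * (w i)%:R) <= mass K (fun i => s i * (w i)%:R)
}.

Section Mass.
Context (I : finType).
Implicit Types (J K : {set I}) (s t : I -> R) (L : {set option I}).

Lemma eq_mass K s t : {in K, s =1 t} -> mass K s = mass K t.
Proof. by move=> st; apply: eq_bigr. Qed.

Lemma mass_le K s t : {in K, forall i, s i <= t i} -> mass K s <= mass K t.
Proof. by move=> st; apply: ler_sum. Qed.

Lemma mass_eq0 K s : {in K, forall i, s i = 0} -> mass K s = 0.
Proof. by move=> s0; exact: big1. Qed.

Lemma mass_ge0 K s : {in K, forall i, 0 <= s i} -> 0 <= mass K s.
Proof. by move=> st; apply: sumr_ge0. Qed.

Lemma massID J K s : J \subset K -> mass K s = mass J s + mass (K :\: J) s.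
Proof. by move=> JK; rewrite /mass (big_setID J)/= (setIidPr JK). Qed.

Lemma mass_sub J K s :
  J \subset K -> {in K, forall i, 0 <= s i} -> mass J s <= mass K s.
Proof.
move=> JK s0; rewrite (massID _ JK) lerDl mass_ge0// => i.
by rewrite inE => /andP[_]; exact: s0.
Qed.

Lemma massD K s t : mass K (fun i => s i + t i) = mass K s + mass K t.
Proof. exact: big_split. Qed.

Lemma massB K s t : mass K (fun i => s i - t i) = mass K s - mass K t.
Proof. by rewrite massD /mass sumrN. Qed.

Lemma massMr K s c : mass K (fun i => s i * c) = mass K s * c.
Proof. by rewrite /mass mulr_suml. Qed.

Lemma mass1 i s : mass [set i] s = s i.
Proof. exact: big_set1. Qed.

Lemma mass_option L (f : option I -> R) :
  mass L f = mass (Some @^-1: L) (fun i => f (Some i)) +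
              (if None \in L then f None else 0).
Proof. exact: big_option. Qed.

Lemma mass_blow J L s :
  mass L (blow J s) =
  mass (Some @^-1: L) s + (if None \in L then mass J s - 1 else 0).
Proof. exact: mass_option. Qed.

End Mass.

Lemma latticeD d x y : lattice d x -> lattice d y -> lattice d (x + y).
Proof. by move=> [m ->] [n ->]; exists (m + n)%N; rewrite natrD mulrDl. Qed.

Lemma lattice_mass (I : finType) (K : {set I}) (s : I -> R) d :
  {in K, forall i, lattice d (s i)} -> lattice d (mass K s).
Proof.
move=> sd; apply: (big_ind (lattice d)) => //; last exact: latticeD.
by exists 0%N; rewrite mul0r.
Qed.

Lemma lattice_sub1 d x : (0 < d)%N -> lattice d x -> 1 <= x -> lattice d (x - 1).
Proof.
move=> d0 [n ->]; have dR : 0 < d%:R :> R by rewrite ltr0n.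
rewrite ler_pdivlMr// mul1r ler_nat => dn; exists (n - d)%N.
by rewrite natrB// mulrBl divff// gt_eqF.
Qed.

Section Transform.
Context (I : finType) (H : {set {set I}}) (P : point_family I) (d : nat).
Context (S : is_system H P d).
Implicit Types (J K : {set I}) (L : {set option I}).

Lemma singular_mass J K s :
  singular H P J -> K \in H -> J \subset K -> P K s -> 1 <= mass J s.
Proof.
move=> [JH J1] KH JK Ps; have [t Pt ts] := sys_restr S KH JK Ps.
by rewrite -(eq_mass ts); exact: J1.
Qed.

Lemma singular_sup J K :
  singular H P J -> K \in H -> J \subset K -> singular H P K.
Proof.
move=> Js KH JK; split=> // s Ps; apply: le_trans (singular_mass Js KH JK Ps) _.
by apply: mass_sub => //; exact: sys_ge0 S _ _ KH Ps.
Qed.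

Lemma singular_pi J L : singular H P J ->
  singular (blowup_strata H J) (transform J P) L -> singular H P (pi_sharp J L).
Proof.
move=> Js [LH L1]; move: (LH); rewrite in_blowup_strata => /andP[KH _].
have [nL|nL] := boolP (None \in L).
  by apply: singular_sup Js KH _; exact: pi_sharp_center.
split=> // s Ps; have := L1 _ (ex_intro2 _ _ s Ps erefl).
by rewrite mass_blow (negbTE nL) addr0 /pi_sharp (negbTE nL).
Qed.

Lemma blow_eq J L K s t : Some @^-1: L \subset K -> (None \in L -> J \subset K) ->
  {in K, s =1 t} -> {in L, blow J s =1 blow J t}.
Proof.
move=> LK JK st [i|] iL /=; first by apply/st/(subsetP LK); rewrite inE.
by congr (_ - _); apply: eq_mass => i iJ; apply/st/(subsetP (JK iL)).
Qed.

Lemma transform_system J :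
  singular H P J -> is_system (blowup_strata H J) (transform J P) d.
Proof.
move=> Js; have strat L : L \in blowup_strata H J -> pi_sharp J L \in H.
  exact: pi_sharp_strata.
split.
- exact: sys_d S.
- move=> L1 L2 L2H L12; apply: blowup_strata_down L2H L12 => K1 K2.
  exact: sys_down S _ _.
- by move=> L /strat/(sys_ne S)[s Ps]; exists (blow J s), s.
- move=> L _ LH [s Ps ->] [i|] iL /=.
    apply: (sys_ge0 S (strat _ LH) Ps); apply: (subsetP (pi_sharp_sup J L)).
    by rewrite inE.
  by rewrite subr_ge0 (singular_mass Js (strat _ LH) _ Ps)// pi_sharp_center.
- move=> L1 L2 _ L2H L12 [s Ps ->].
  have [t Pt ts] := sys_restr S (strat _ L2H) (pi_sharpS J L12) Ps.
  exists (blow J t); first by exists t.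
  by apply: blow_eq ts; [exact: pi_sharp_sup|exact: pi_sharp_center].
- move=> L1 L2 _ L2H L12 [s Ps ->].
  have [t Pt ts] := sys_lift S (strat _ L2H) (pi_sharpS J L12) Ps.
  exists (blow J t); first by exists t.
  by apply: blow_eq ts; [exact: pi_sharp_sup|exact: pi_sharp_center].
move=> L _ w LH [s Ps ->]; set K := pi_sharp J L.
(* The form with weights [w] on [L] pulls back along [blow] to the weights [u + v] on [K]: [w None]
   is added at every vertex of the center, and the shift by 1 contributes the constant [w None]. *)
pose u i := if Some i \in L then w (Some i) else 0%N.
pose v i := if (None \in L) && (i \in J) then w None else 0%N.
have tot t : mass K (fun i => t i * (u i + v i)%:R) =
    mass L (fun o => blow J t o * (w o)%:R) +
    (if None \in L then (w None)%:R else 0).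
  rewrite mass_option/= -/K.
  under [LHS]eq_mass => i _ do rewrite natrD mulrDr.
  rewrite massD -addrA; congr (_ + _).
    rewrite (massID _ (pi_sharp_sup J L)) [X in _ + X]mass_eq0 ?addr0; last first.
      by move=> i; rewrite !inE /u => /andP[/negbTE ->]; rewrite mulr0.
    by apply: eq_mass => i; rewrite inE /u => ->.
  case: ifPn => nL; last by rewrite addr0 mass_eq0// => i _; rewrite /v (negbTE nL) mulr0.
  rewrite (massID _ (pi_sharp_center J nL)) [X in _ + X]mass_eq0 ?addr0; last first.
    by move=> i; rewrite !inE /v => /andP[/negbTE ->]; rewrite andbF mulr0.
  rewrite mulrBl mul1r subrK -massMr.
  by apply: eq_mass => i iJ; rewrite /v nL iJ.
have [t Pt [td]] := sys_disc S (fun i => u i + v i)%N (strat _ LH) Ps.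
rewrite !tot lerD2r => ts; exists (blow J t); first by exists t.
split=> // -[i|] iL /=.
  by apply: td; apply: (subsetP (pi_sharp_sup J L)); rewrite inE.
have JK := pi_sharp_center J iL.
apply: lattice_sub1; first exact: sys_d S.
  by apply: lattice_mass => i iJ; apply/td/(subsetP JK).
exact: singular_mass Js (strat _ LH) JK Pt.
Qed.

(** For [M = 0] and [mu = 1] the minimal mass on every singular stratum is exactly 1. *)
Definition bounded (M : I -> R) (mu : R) := forall K, singular H P K ->
  exists2 s, P K s & mass K s <= mass K M + mu.

Definition minorant (M : I -> R) :=
  forall K s, K \in H -> P K s -> {in K, forall i, M i <= s i}.

End Transform.

(** The value at infinity is chosen so that [(s - M) / mu] is again transformed by [blow]; see
    [blow_excess]. *)
Definition blow_minorant (I : finType) (J : {set I}) (M : I -> R) (mu : R)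
  (o : option I) : R := if o is Some i then M i else mass J M + mu - 1.

Section Bounded.
Context (I : finType) (H : {set {set I}}) (P : point_family I) (d : nat).
Context (S : is_system H P d) (J : {set I}) (Js : singular H P J).
Local Notation H' := (blowup_strata H J).
Local Notation P' := (transform J P).

Lemma transform_minorant M mu : minorant H P M ->
  (forall s, P J s -> mass J M + mu <= mass J s) ->
  minorant H' P' (blow_minorant J M mu).
Proof.
move=> MP Jmu L _ LH [s Ps ->]; have KH := pi_sharp_strata LH.
move=> [i|] iL /=.
  by apply: (MP _ _ KH Ps); apply: (subsetP (pi_sharp_sup J L)); rewrite inE.
have [t Pt ts] := sys_restr S KH (pi_sharp_center J iL) Ps.
by rewrite lerD2r -(eq_mass ts) Jmu.
Qed.

(** Put [N = s - M >= 0]. Through infinity the new excess is the mass of [N] on the old vertices of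
    [L], plus that on [J], minus [mu]; both masses are at most that of [N] on [pi_sharp J L], hence
    at most [mu]. *)
Lemma transform_bounded M mu : minorant H P M -> bounded H P M mu ->
  bounded H' P' (blow_minorant J M mu) mu.
Proof.
move=> MP Pmu L Ls; have Ks := singular_pi S Js Ls.
have [s Ps sM] := Pmu _ Ks; exists (blow J s); first by exists s.
have n0 : {in pi_sharp J L, forall i, 0 <= s i - M i}.
  by move=> i iK; rewrite subr_ge0; apply: MP Ps _ iK; case: Ks.
rewrite mass_blow (mass_option L (blow_minorant J M mu))/=.
have := mass_sub (pi_sharp_sup J L) n0; rewrite !massB.
case: ifPn => nL; last by lra.
have := mass_sub (pi_sharp_center J nL) n0; rewrite !massB.
by lra.
Qed.

End Bounded.

Lemma bounded0_1 (I : finType) (H : {set {set I}}) (P : point_family I) d J :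
  is_system H P d -> singular H P J -> bounded H P (fun=> 0) 1 ->
  bounded (blowup_strata H J) (transform J P) (fun=> 0) 1.
Proof.
move=> S Js B; have -> : (fun=> 0) = blow_minorant J (fun=> 0) 1.
  by apply: funext => -[i|] //=; rewrite mass_eq0// add0r subrr.
apply: (transform_bounded S Js) B => K s KH Ps i iK.
exact: sys_ge0 S _ _ KH Ps _ iK.
Qed.

End Families.

(** * The monomial case *)

Section Monomial.
Context (R : realType).

Definition scaled (d : nat) (I : finType) (m : I -> nat) (i : I) : R := (m i)%:R / d%:R.

Lemma mass_scaled d (I : finType) (K : {set I}) (m : I -> nat) :
  mass K (scaled d m) = (\sum_(i in K) m i)%:R / d%:R.
Proof. by rewrite /mass -mulr_suml natr_sum. Qed.

Lemma blow_scaled d mu (I : finType) (J : {set I}) (m : I -> nat) :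
  (0 < d)%N -> (d <= \sum_(i in J) m i + mu)%N ->
  blow_minorant J (scaled d m) (mu%:R / d%:R) =
  scaled d (fun o => if o is Some i then m i else \sum_(i in J) m i + mu - d)%N.
Proof.
move=> d0 dm; apply: funext => -[i|] //=.
have dR : d%:R != 0 :> R by rewrite pnatr_eq0 -lt0n.
by rewrite mass_scaled /scaled natrB// natrD !mulrDl mulNr divff.
Qed.

(* Blowing up a minimal stratum J with M(J) >= 1 makes M(L) smaller than M(K) on
   every new stratum L over K, so the maximal value of M is taken less often. *)
Lemma monomial_resolvable v c (I : finType) (H : {set {set I}}) (P : point_family R I) d
    (m : I -> nat) :
  is_system H P d -> minorant H P (scaled d m) -> bounded H P (scaled d m) 0 ->
  (forall K, singular H P K -> \sum_(i in K) m i < v)%N ->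
  (#|[set K in H | \sum_(i in K) m i == v.-1]| <= c)%N ->
  resolvable H P.
Proof.
(* Lexicographic induction: [v] strictly bounds the sums of [m] on singular strata, and [c] bounds
   the number of strata where the sum is [v - 1]. *)
elim: v c I H P m => [|v IHv] c.
  move=> I H P m _ _ _ mv _; apply: resolvable_nil => K /mv.
  by rewrite ltn0.
elim: c => [|c IHc] I H P m S MP MB mv /= mc.
all: have d0 := sys_d S; have dR : 0 < d%:R :> R by rewrite ltr0n.
all: have sing_ge K : singular H P K -> (d <= \sum_(i in K) m i)%N by
  move=> Ks; have [s Ps] := MB _ Ks; have := Ks.2 s Ps;
  rewrite addr0 mass_scaled => s1 /(le_trans s1);
  rewrite ler_pdivlMr// mul1r ler_nat.
  apply: (IHv _ _ _ _ _ S MP MB _ (leqnn _)) => K Ks.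
  rewrite ltn_neqAle -ltnS mv// andbT; apply/negP => /eqP Kv.
  move: mc; rewrite leqn0 cards_eq0 => /eqP/setP/(_ K).
  by rewrite !inE Kv eqxx Ks.1.
have [/existsP[K /and3P[KH /eqP Kv dK]]|/existsPn noK] :=
  boolP [exists K : {set I}, [&& K \in H, \sum_(i in K) m i == v & d <= \sum_(i in K) m i]%N];
  last first.
  apply: (IHv _ _ _ _ _ S MP MB _ (leqnn _)) => K Ks.
  rewrite ltn_neqAle -ltnS mv// andbT; apply: contra (noK K) => ->.
  by rewrite Ks.1 sing_ge.
have [J /minsetP[dJ Jmin] JK] :=
  @minset_exists _ (fun A : {set I} => d <= \sum_(i in A) m i)%N _ dK.
have Js : singular H P J.
  split=> [|s Ps]; first exact: sys_down S _ _ KH JK.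
  have : mass J (scaled d m) <= mass J s.
    by apply: mass_le => i iJ; apply: MP Ps _ iJ; exact: sys_down S _ _ KH JK.
  by apply: le_trans; rewrite mass_scaled ler_pdivlMr// mul1r ler_nat.
pose m' (o : option I) := if o is Some i then m i else (\sum_(i in J) m i + 0 - d)%N.
have M'E : blow_minorant J (scaled d m) 0 = scaled d m'.
  by rewrite -blow_scaled ?mul0r// addn0.
(* The two sums differ by [d] minus the sum of [m] over the vertices of [J] left in [L], which is
   positive by minimality of [J]. *)
have drop L : L \in blowup_strata H J -> None \in L ->
    (\sum_(o in L) m' o < \sum_(i in pi_sharp J L) m i)%N.
  rewrite in_blowup_strata => /andP[_ JL] nL.
  rewrite big_option nL /m' addn0 /pi_sharp nL.
  rewrite [X in (_ < X)%N](big_setID (Some @^-1: L))/= (setIidPr (subsetUl _ _)).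
  rewrite ltn_add2l -ltnS ltnS.
  have -> : (Some @^-1: L :|: J) :\: Some @^-1: L = J :\: Some @^-1: L.
    by rewrite setDUl setDv set0U.
  rewrite ltn_subLR// (big_setID (Some @^-1: L))/= ltn_add2r.
  rewrite ltnNge; apply: contra JL => /Jmin/(_ (subsetIl _ _))/setIidPl.
  by [].
apply: (resolvable_step Js).
have S' := transform_system S Js.
apply: (IHc _ _ _ m' S').
- rewrite -M'E; apply: (transform_minorant S MP) => s Ps.
  by rewrite addr0; apply: mass_le => i; exact: MP Js.1 Ps _.
- by rewrite -M'E; exact: (transform_bounded S Js MP MB).
- move=> L Ls; have Ks := singular_pi S Js Ls.
  have [nL|nL] := boolP (None \in L).
    by apply: ltn_trans (mv _ Ks); apply: drop nL; exact: Ls.1.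
  have := mv _ Ks; rewrite big_option/= (negbTE nL) addn0.
  by rewrite /pi_sharp (negbTE nL).
(* A new stratum with sum [v] cannot pass through infinity, so it is an old one not containing [J];
   this excludes [K]. *)
rewrite -ltnS; apply: leq_trans mc; rewrite (cardsD1 K) !inE KH Kv eqxx add1n ltnS.
rewrite -[X in (_ <= X)%N](card_imset _ (imset_inj (@Some_inj _))); apply: subset_leq_card.
apply/subsetP => L; rewrite inE => /andP[LH /eqP Lv].
have [KLH JL] : pi_sharp J L \in H /\ ~~ (J \subset Some @^-1: L).
  by move: LH; rewrite in_blowup_strata => /andP.
have [nL|nL] := boolP (None \in L).
  have := mv _ (singular_sup S Js KLH (pi_sharp_center J nL)).
  by have := drop _ LH nL; rewrite Lv ltnS ltnNge => /negbTE ->.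
move: KLH Lv; rewrite /pi_sharp (negbTE nL) big_option/= (negbTE nL) addn0 => KLH Lv.
rewrite -(imset_preim_Some nL) mem_imset ?inE; last exact: imset_inj (@Some_inj _).
rewrite KLH Lv eqxx !andbT; apply: contraNneq JL => ->; exact: JK.
Qed.
End Monomial.

(** * Companion systems and the descent of [mu] *)

Section Companion.
Context (R : realType).

Definition excess (I : finType) (M : I -> R) (mu : R) (s : I -> R) (i : I) : R :=
  (s i - M i) / mu.

(** A union of point sets: for [mu > 0], a stratum is singular for it exactly when its points have
    mass at least 1 and excess over [M] of mass at least [mu]. *)
Definition companion (I : finType) (P : point_family R I) (M : I -> R) (mu : R) :
    point_family R I :=
  fun K t => P K t \/ exists2 s, P K s & t = excess M mu s.

Lemma mass_excess (I : finType) (K : {set I}) (M : I -> R) mu s :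
  mass K (excess M mu s) = (mass K s - mass K M) / mu.
Proof. by rewrite massMr massB. Qed.

Lemma blow_excess (I : finType) (J : {set I}) (M : I -> R) mu s : mu != 0 ->
  blow J (excess M mu s) = excess (blow_minorant J M mu) mu (blow J s).
Proof.
move=> mu0; apply: funext => -[i|] //=; rewrite mass_excess /excess/=.
by field.
Qed.

(** The excess of a lattice point has coordinates [(n - m i) / k], so the mesh [1 / (d * k)] serves
    both kinds of points. *)
Lemma companion_system (I : finType) (H : {set {set I}}) (P : point_family R I) d k m :
  is_system H P d -> minorant H P (scaled R d m) -> (0 < k)%N ->
  is_system H (companion P (scaled R d m) (k%:R / d%:R)) (d * k).
Proof.
move=> S MP k0; set M := scaled R d m; set mu := k%:R / d%:R.
have d0 := sys_d S.
have dR : 0 < d%:R :> R by rewrite ltr0n.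
have kR : 0 < k%:R :> R by rewrite ltr0n.
have mu0 : 0 < mu by rewrite divr_gt0.
split.
- by rewrite muln_gt0 d0.
- exact: sys_down S.
- by move=> K /(sys_ne S)[s Ps]; exists s; left.
- move=> K t KH [|[s Ps ->]] => [|i iK]; first exact: sys_ge0 S _ _ KH.
  by rewrite divr_ge0 ?subr_ge0 ?(MP _ _ KH Ps)// ltW.
- move=> J K t KH JK [/(sys_restr S KH JK)[s Ps st]|[s Ps ->]].
    by exists s => //; left.
  have [u Pu us] := sys_restr S KH JK Ps.
  exists (excess M mu u); first by right; exists u.
  by move=> i iJ; rewrite /excess us.
- move=> J K t KH JK [/(sys_lift S KH JK)[s Ps st]|[s Ps ->]].
    by exists s => //; left.
  have [u Pu us] := sys_lift S KH JK Ps.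
  exists (excess M mu u); first by right; exists u.
  by move=> i iJ; rewrite /excess us.
move=> K t w KH [/(sys_disc S w KH)[s Ps [sd st]]|[s /(sys_disc S w KH)[u Pu [ud us]] ->]].
  exists s; first by left.
  split=> // i /sd[n ->]; exists (n * k)%N.
  by rewrite !natrM; field; rewrite !gt_eqF.
exists (excess M mu u); first by right; exists u.
split=> [i iK|].
  have [n un] := ud i iK; have := MP _ _ KH Pu i iK.
  rewrite /excess un /M /scaled ler_pM2r ?invr_gt0// ler_nat => mn.
  exists ((n - m i) * d)%N; rewrite !natrM natrB// /mu.
  by field; rewrite !gt_eqF.
have E (v : I -> R) : mass K (fun i => excess M mu v i * (w i)%:R) =
    (mass K (fun i => v i * (w i)%:R) - mass K (fun i => M i * (w i)%:R)) / mu.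
  rewrite -massB -massMr; apply: eq_mass => i _; rewrite /excess.
  by field; rewrite gt_eqF.
by rewrite !E ler_pM2r ?invr_gt0// lerD2r.
Qed.

(** A resolution of the companion is replayed on [P]: its centers are singular for [P], and
    companions commute with transforms. At its end [mu] has dropped to [k / d]. [Q] need agree with
    the companion only on strata, a relation that passes to transforms. *)
Lemma companion_resolvable n d k (I : finType) (H : {set {set I}})
    (Q P : point_family R I) (m : I -> nat) :
  (forall (I' : finType) (H' : {set {set I'}}) (P' : point_family R I') (m' : I' -> nat),
     is_system H' P' d -> {in H', forall K : {set I'}, #|K| <= n}%N ->
     minorant H' P' (scaled R d m') -> bounded H' P' (scaled R d m') (k%:R / d%:R) ->
     resolvable H' P') ->
  resolvable H Q ->
  is_system H P d -> {in H, forall K : {set I}, #|K| <= n}%N ->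
  minorant H P (scaled R d m) -> bounded H P (scaled R d m) (k.+1%:R / d%:R) ->
  (forall K t, K \in H -> Q K t <-> companion P (scaled R d m) (k.+1%:R / d%:R) K t) ->
  resolvable H P.
Proof.
move=> IH res; elim: res P m => {I H Q} [I H Q noQ|I H Q J [JH J1] _ IHJ] P m S Hn MP MB QP.
  have d0 := sys_d S; have dR : 0 < d%:R :> R by rewrite ltr0n.
  have mu0 : 0 < k.+1%:R / d%:R :> R by rewrite divr_gt0.
  apply: (IH _ _ _ m S Hn MP) => K Ks; have KH := Ks.1.
  have [t Qt t1] : exists2 t, Q K t & mass K t < 1.
    apply: contrapT => nt; apply: (noQ K); split=> // t Qt.
    by rewrite leNgt; apply/negP => t1; apply: nt; exists t.
  have {Qt} [/(Ks.2 t)|[s Ps tE]] := (QP K t KH).1 Qt; first by rewrite leNgt t1.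
  move: t1; rewrite tE mass_excess ltr_pdivrMr// mul1r => sM.
  (* Moving to a lattice point turns an excess below [(k + 1) / d] into one of at most [k / d]. *)
  have [u Pu [ud us]] := sys_disc S (fun=> 1%N) KH Ps.
  exists u => //; have {us} : mass K u <= mass K s.
    by move: us; rewrite !massMr !mulr1.
  move=> us; have := le_lt_trans (lerB us (lexx (mass K (scaled R d m)))) sM.
  have [a ->] := lattice_mass ud; rewrite mass_scaled ltrBlDr -!mulrDl -!natrD.
  by rewrite ltr_pM2r ?invr_gt0// ler_pM2r ?invr_gt0// ltr_nat ler_nat addSn ltnS addnC.
have d0 := sys_d S; have dR : 0 < d%:R :> R by rewrite ltr0n.
have mu0 : 0 < k.+1%:R / d%:R :> R by rewrite divr_gt0.
have Js : singular H P J by split=> // s Ps; apply: J1; apply/QP => //; left.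
have Jmu s : P J s -> mass J (scaled R d m) + k.+1%:R / d%:R <= mass J s.
  move=> Ps; have : 1 <= mass J (excess (scaled R d m) (k.+1%:R / d%:R) s).
    by apply: J1; apply/QP => //; right; exists s.
  by rewrite mass_excess ler_pdivlMr// mul1r lerBrDl.
(* Keeps the truncated subtraction in the new value at infinity exact. *)
have dm : (d <= \sum_(i in J) m i + k.+1)%N.
  have [s Ps] := MB _ Js; have := Js.2 _ Ps; rewrite mass_scaled => s1 /(le_trans s1).
  by rewrite -mulrDl -natrD ler_pdivlMr// mul1r ler_nat.
apply: (resolvable_step Js).
have S' := transform_system S Js.
apply: (IHJ _ (fun o => if o is Some i then m i else \sum_(i in J) m i + k.+1 - d)%N S').
- by move=> L; exact: card_blowup_strata.
- by rewrite -blow_scaled//; exact: (transform_minorant S MP).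
- by rewrite -blow_scaled//; exact: (transform_bounded S Js MP MB).
move=> L t LH; have KH := pi_sharp_strata LH; rewrite -blow_scaled//.
split.
  move=> [s /(QP _ _ KH)[Ps|[u Pu ->]] ->]; first by left; exists s.
  right; exists (blow J u); first by exists u.
  by rewrite blow_excess// gt_eqF.
move=> [[s Ps ->]|[_ [s Ps ->] ->]].
  by exists s => //; apply/QP => //; left.
exists (excess (scaled R d m) (k.+1%:R / d%:R) s).
  by apply/QP => //; right; exists s.
by rewrite blow_excess// gt_eqF.
Qed.

Lemma resolvable_from_bounded n :
  (forall (I : finType) (H : {set {set I}}) (P : point_family R I) d,
     is_system H P d -> {in H, forall K : {set I}, #|K| <= n}%N ->
     bounded H P (fun=> 0) 1 -> resolvable H P) ->
  forall (I : finType) (H : {set {set I}}) (P : point_family R I) d,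
    is_system H P d -> {in H, forall K : {set I}, #|K| <= n}%N -> resolvable H P.
Proof.
move=> IH I H P d S Hn.
(* Induction on [k = d * mu]; for [k = 0] the minimal masses are those of [M], the monomial case. *)
have main k : forall (I' : finType) (H' : {set {set I'}}) (P' : point_family R I') (m' : I' -> nat),
     is_system H' P' d -> {in H', forall K : {set I'}, #|K| <= n}%N ->
     minorant H' P' (scaled R d m') -> bounded H' P' (scaled R d m') (k%:R / d%:R) ->
     resolvable H' P'.
  elim: k => [|k IHk] {I H P S Hn} I H P m S Hn MP MB.
    rewrite mul0r in MB; apply: (monomial_resolvable (v := (\sum_i m i).+1) S MP MB _ (leqnn _)).
    move=> K _; rewrite ltnS [X in (_ <= X)%N](bigID (mem K))/=; exact: leq_addr.
  have d0 := sys_d S; have dR : 0 < d%:R :> R by rewrite ltr0n.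
  apply: (companion_resolvable IHk _ S Hn MP MB (fun _ _ _ => iff_refl _)).
  apply: (IH _ _ _ _ (companion_system S MP _)) => // K [KH K1].
  have Ks : singular H P K by split=> // s Ps; apply: K1; left.
  have [s Ps sM] := MB _ Ks; exists (excess (scaled R d m) (k.+1%:R / d%:R) s).
    by right; exists s.
  rewrite mass_excess [mass K (fun=> 0)]mass_eq0// add0r ler_pdivrMr ?divr_gt0//.
  by rewrite mul1r lerBlDl.
(* To start, [M = 0] and [mu] is the sum over all strata of the mass of one lattice point each. *)
have ex K : exists a : nat, K \in H -> exists2 s, P K s & mass K s = a%:R / d%:R.
  have [KH|KH] := boolP (K \in H); last by exists 0%N.
  have [s Ps] := sys_ne S KH; have [t Pt [td _]] := sys_disc S (fun=> 0%N) KH Ps.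
  by have [a ta] := lattice_mass td; exists a => _; exists t.
have [a aP] := choice ex.
have M0 : scaled R d (fun=> 0%N) = (fun=> 0 : R) :> (I -> R).
  by apply: funext => i; rewrite /scaled mul0r.
apply: (main (\sum_(K in H) a K)%N _ _ _ (fun=> 0%N) S Hn); rewrite M0.
  by move=> K s KH Ps; exact: sys_ge0 S _ _ KH Ps.
move=> K [KH _]; have [s Ps sa] := aP K KH; exists s => //.
rewrite sa mass_eq0// add0r ler_pM2r ?invr_gt0 ?ltr0n ?(sys_d S)// ler_nat.
by rewrite (bigD1 K)//= leq_addr.
Qed.
End Companion.

(** * Links, contact sets and the induction on dimension *)

Section MaximalContact.
Context (R : realType).

Section Link.
Context (I : finType).
Implicit Types (H : {set {set I}}) (P : point_family R I) (J K : {set I}).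

Definition link_strata H (j : I) : {set {set I}} :=
  [set K : {set I} | (j \notin K) && (j |: K \in H)].

(* Hironaka's projection of a point from the vertex [j]. *)
Definition project (j : I) (s : I -> R) (i : I) : R := s i / (1 - s j).

(** Points with [s j >= 1] are dropped: their coordinates being non-negative, they already have mass
    at least 1 on strata through [j]. *)
Definition link P (j : I) : point_family R I :=
  fun K t => exists s, [/\ P (j |: K) s, s j < 1 & t = project j s].

Lemma massU1 K j (s : I -> R) : j \notin K -> mass (j |: K) s = s j + mass K s.
Proof. exact: big_setU1. Qed.

Lemma mass_project K j (s : I -> R) : mass K (project j s) = mass K s / (1 - s j).
Proof. exact: massMr. Qed.

(** The quotient of [a / d] by [1 - b / d] is [a / (d - b)], and [d - b], lying between 1 and [d],
    divides the factorial of [d]. *)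
Lemma lattice_quotient d (x y : R) : (0 < d)%N -> lattice d x -> lattice d y -> y < 1 ->
  lattice d`! (x / (1 - y)).
Proof.
move=> d0 [a ->] [b ->]; have dR : 0 < d%:R :> R by rewrite ltr0n.
rewrite ltr_pdivrMr// mul1r ltr_nat => bd.
have /dvdnP[q qE] : (d - b %| d`!)%N by rewrite dvdn_fact// subn_gt0 bd leq_subr.
have fR : d`!%:R != 0 :> R by rewrite pnatr_eq0 -lt0n fact_gt0.
have bR : d%:R - b%:R != 0 :> R by rewrite subr_eq0 eqr_nat gtn_eqF.
exists (a * q)%N; have qR : q%:R * (d%:R - b%:R) = d`!%:R :> R.
  by rewrite qE natrM natrB// ltnW.
have q0 : q%:R != 0 :> R by apply: contraNneq fR => q0; rewrite -qR q0 mul0r.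
rewrite -qR natrM; field.
by rewrite bR q0 gt_eqF.
Qed.

(** The point with [s j < 1] lifts to every stratum through [j], so no point set of the link is
    empty. *)
Lemma link_system H P d j : is_system H P d -> (exists2 s, P [set j] s & s j < 1) ->
  is_system (link_strata H j) (link P j) d`!.
Proof.
move=> S [s0 Ps0 s0j].
have inH K : K \in link_strata H j -> j \notin K /\ j |: K \in H.
  by rewrite inE => /andP.
have jK K : j \in j |: K by rewrite setU11.
split.
- exact: fact_gt0.
- move=> J K /inH[jK' KH] JK; rewrite inE (contra _ jK'); last by move/(subsetP JK).
  by apply: sys_down S _ _ KH _; exact: setUS.
- move=> K /inH[jK' KH].
  have [s Ps s0s] := sys_lift S KH (subsetUl _ _) Ps0.
  by exists (project j s), s; split=> //; rewrite s0s ?set11.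
- move=> K _ /inH[jK' KH] [s [Ps sj ->]] i iK.
  by rewrite divr_ge0 ?subr_ge0 ?(ltW sj)// (sys_ge0 S KH Ps)// setU1r.
- move=> J K _ /inH[jK' KH] JK [s [Ps sj ->]].
  have [t Pt ts] := sys_restr S KH (setUS [set j] JK) Ps.
  exists (project j t); first by exists t; split=> //; rewrite ts// setU11.
  by move=> i iJ; rewrite /project !ts// ?setU11// setU1r.
- move=> J K _ /inH[jK' KH] JK [s [Ps sj ->]].
  have [t Pt ts] := sys_lift S KH (setUS [set j] JK) Ps.
  exists (project j t); first by exists t; split=> //; rewrite ts// setU11.
  by move=> i iJ; rewrite /project !ts// ?setU11// setU1r.
move=> K _ w /inH[jK' KH] [s [Ps sj ->]].
have d0 := sys_d S; set D := d`!.
have DR : 0 < D%:R :> R by rewrite ltr0n fact_gt0.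
pose W (u : I -> R) := mass K (fun i => u i * (w i)%:R).
have W0 u : P (j |: K) u -> 0 <= W u.
  move=> Pu; apply: mass_ge0 => i iK; rewrite mulr_ge0//.
  by rewrite (sys_ge0 S KH Pu)// setU1r.
have EW u : mass K (fun i => project j u i * (w i)%:R) = W u / (1 - u j).
  by rewrite /W -massMr; apply: eq_mass => i _; rewrite /project mulrAC.
pose c := W s / (1 - s j).
have sj' : 0 < 1 - s j by rewrite subr_gt0.
have c0 : 0 <= c by rewrite divr_ge0 ?W0// ltW.
(* The denominator leaves no value of the projected linear form in ]c, p / D[. *)
pose p := (Num.truncn (D%:R * c)).+1.
have cp : D%:R * c < p%:R by exact: truncnS_gt.
have gap x : lattice D x -> x * D%:R < p%:R -> x <= c.
  move=> [a ->]; rewrite divfK ?gt_eqF// ltr_nat ltnS => ap.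
  rewrite ler_pdivrMr// mulrC.
  by apply: le_trans (_ : (Num.truncn (D%:R * c))%:R <= _); rewrite ?ler_nat// truncn_le// mulr_ge0// ltW.
have Ev (u : I -> R) : mass (j |: K) (fun i => u i * (if i == j then p else D * w i)%N%:R) =
    u j * p%:R + D%:R * W u.
  rewrite massU1// eqxx; congr (_ + _); rewrite /W mulrC -massMr.
  apply: eq_mass => i iK; have /negbTE -> : i != j by apply: contraNneq jK' => <-.
  by rewrite natrM; ring.
(* With weight [p] on [j] the point [s] has value below [p]. So has [u], which forces [u j < 1] and
   keeps the projected value of [u] below [p / D]. *)
have [u Pu [ud]] := sys_disc S (fun i => if i == j then p else D * w i)%N KH Ps.
rewrite !Ev => us; have Wu := W0 _ Pu.
have pR : 0 < p%:R :> R by rewrite ltr0n.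
have Ws : W s = c * (1 - s j) by rewrite /c divfK// gt_eqF.
have up : u j * p%:R + D%:R * W u < p%:R.
  apply: le_lt_trans us _; rewrite Ws; nra.
have uj : u j < 1 by nra.
have uj' : 0 < 1 - u j by rewrite subr_gt0.
exists (project j u); first by exists u.
split=> [i iK|].
  by apply: lattice_quotient => //; apply: ud; rewrite ?jK// setU1r.
rewrite !EW; apply: gap.
  apply: lattice_quotient => //; last exact: ud.
  apply: lattice_mass => i iK; have [a ->] : lattice d (u i) by apply: ud; rewrite setU1r.
  by exists (a * w i)%N; rewrite natrM mulrAC.
by rewrite mulrAC ltr_pdivrMr//; nra.
Qed.

End Link.

Lemma link_pi_sharp (I : finType) (J : {set I}) (L : {set option I}) j :
  pi_sharp (j |: J) (Some j |: L) = j |: pi_sharp J L.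
Proof.
rewrite /pi_sharp !inE/=; case: ifP => _; apply/setP => i; rewrite !inE/=.
  by rewrite (inj_eq (@Some_inj _)); case: (i == j).
by rewrite (inj_eq (@Some_inj _)).
Qed.

Lemma link_blowup_strata (I : finType) (H : {set {set I}}) (J : {set I}) j : j \notin J ->
  link_strata (blowup_strata H (j |: J)) (Some j) = blowup_strata (link_strata H j) J.
Proof.
move=> jJ; apply/setP => L; rewrite inE !in_blowup_strata link_pi_sharp inE.
have jpi : (j \in pi_sharp J L) = (Some j \in L).
  by rewrite /pi_sharp; case: ifP => _; rewrite !inE ?(negbTE jJ) ?orbF.
rewrite jpi -andbA; congr [&& _, _ & ~~ _].
apply/subsetP/subsetP => sub i.
  move=> iJ; have := sub i (setU1r _ iJ); rewrite !inE (inj_eq (@Some_inj _)).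
  by case/orP => // /eqP ij; rewrite -ij iJ in jJ.
by rewrite !inE (inj_eq (@Some_inj _)) => /orP[->//|/sub]; rewrite inE => ->; rewrite orbT.
Qed.

(** At infinity both sides equal [(mass J s + s j - 1) / (1 - s j)]. *)
Lemma blow_project (I : finType) (J : {set I}) j (s : I -> R) : j \notin J -> s j < 1 ->
  blow J (project j s) = project (Some j) (blow (j |: J) s).
Proof.
move=> jJ sj; apply: funext => -[i|] //=; rewrite mass_project /project/= massU1//.
by field; rewrite subr_eq0 gt_eqF.
Qed.

(** A resolution of the link is replayed with [j] added to each center, carrying the invariant [Q].
    At its end no singular stratum contains [j], and the last hypothesis on [Q] takes over. *)
Lemma link_resolvable (Q : forall I : finType, {set {set I}} -> point_family R I -> I -> Prop) :
  (forall (I : finType) (H : {set {set I}}) (P : point_family R I) j, Q I H P j ->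
     exists d, is_system H P d) ->
  (forall (I : finType) (H : {set {set I}}) (P : point_family R I) j J, Q I H P j ->
     singular H P J -> Q _ (blowup_strata H J) (transform J P) (Some j)) ->
  (forall (I : finType) (H : {set {set I}}) (P : point_family R I) j, Q I H P j ->
     (forall K, singular H P K -> j \notin K) -> resolvable H P) ->
  forall (I : finType) (Hl : {set {set I}}) (Pl : point_family R I), resolvable Hl Pl ->
  forall (H : {set {set I}}) (P : point_family R I) j, Q I H P j -> Hl = link_strata H j ->
  (forall K t, K \in Hl -> Pl K t <-> link P j K t) -> resolvable H P.
Proof.
move=> Qsys Qstep Qend I Hl Pl res.
elim: res => {I Hl Pl} [I Hl Pl noS|I Hl Pl J [JH J1] _ IH] H P j QP HlE PlE.
  have [d S] := Qsys _ _ _ _ QP.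
  apply: (Qend _ _ _ _ QP) => K Ks; apply/negP => jK.
  have KE : j |: (K :\ j) = K by exact: setD1K.
  have K0 : K :\ j \in Hl by rewrite HlE !inE eqxx/= KE Ks.1.
  apply: (noS (K :\ j)); split=> // t /(PlE _ _ K0)[s []]; rewrite KE => Ps sj ->.
  have := Ks.2 _ Ps; rewrite -{1}KE massU1 ?setD11// mass_project => s1.
  by rewrite ler_pdivlMr ?subr_gt0// mul1r; lra.
have [d S] := Qsys _ _ _ _ QP.
have [jJ jJH] : j \notin J /\ j |: J \in H by move: (JH); rewrite HlE inE => /andP.
have Js : singular H P (j |: J).
  split=> // s Ps; rewrite massU1//.
  have s0 := sys_ge0 S jJH Ps.
  have sJ : 0 <= mass J s by apply: mass_ge0 => i iJ; apply: s0; rewrite setU1r.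
  have [sj|sj] := ltP (s j) 1; last by lra.
  have := J1 (project j s) ((PlE _ _ JH).2 (ex_intro _ s (And3 Ps sj erefl))).
  by rewrite mass_project ler_pdivlMr ?subr_gt0// mul1r; lra.
apply: (resolvable_step Js); apply: (IH _ _ (Some j)).
- exact: Qstep.
- by rewrite link_blowup_strata// HlE.
move=> L t LH; have KH := pi_sharp_strata LH; split.
  move=> [_ /(PlE _ _ KH)[s [Ps sj ->]] ->].
  exists (blow (j |: J) s); split=> //; last exact: blow_project.
  by exists s => //; rewrite link_pi_sharp.
move=> [_ [[s Ps ->] /= sj ->]]; exists (project j s); last by rewrite blow_project.
by apply/PlE => //; exists s; split=> //; rewrite -link_pi_sharp.
Qed.

Definition contact (I : finType) (P : point_family R I) (K : {set I}) : {set I} :=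
  [set i in K | `[< exists s, [/\ P K s, mass K s = 1 & 0 < s i] >]].

Definition contacts (I : finType) (H : {set {set I}}) (P : point_family R I) : {set {set I}} :=
  [set T : {set I} | `[< exists2 K, singular H P K & contact P K = T >]].

Section Contact.
Context (I : finType) (H : {set {set I}}) (P : point_family R I) (d : nat).
Context (S : is_system H P d).

Lemma contact_neq0 K : bounded H P (fun=> 0) 1 -> singular H P K -> contact P K != set0.
Proof.
move=> B Ks; have [s Ps] := B _ Ks; rewrite [mass _ (fun=> 0)]mass_eq0// add0r => s1.
have {}s1 : mass K s = 1 by apply/eqP; rewrite eq_le s1 (Ks.2 _ Ps).
apply/eqP => c0; have : mass K s <= mass K (fun=> 0).
  apply: mass_le => i iK; rewrite leNgt; apply/negP => si.
  have : i \in contact P K by rewrite inE iK; apply/asboolP; exists s.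
  by rewrite c0 inE.
by rewrite s1 mass_eq0// ler10.
Qed.

(* If J lies in K and s in P K has mass 1, all of it is carried by J; when L over K
   is singular, the rest of J survives in L with the whole mass of s. *)
Lemma contact_transform J L : singular H P J ->
  singular (blowup_strata H J) (transform J P) L ->
  Some @: contact P (pi_sharp J L) \subset contact (transform J P) L.
Proof.
move=> Js Ls; have LH := Ls.1; have KH := pi_sharp_strata LH.
apply/subsetP => _ /imsetP[i + ->]; rewrite inE => /andP[iK /asboolP[s [Ps s1 si]]].
have := Ls.2 _ (ex_intro2 _ _ s Ps erefl); rewrite mass_blow => L1.
have s0 := sys_ge0 S KH Ps.
have PI := pi_sharp_sup J L.
have E := massID s PI.
suff [iL sL] : i \in Some @^-1: L /\ mass L (blow J s) = 1.
  rewrite inE in iL; rewrite inE iL; apply/asboolP; exists (blow J s).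
  by split=> //; exists s.
rewrite mass_blow; move: L1; have [nL|nL] := boolP (None \in L) => L1; last first.
  move: iK E s1; rewrite /pi_sharp (negbTE nL) setDv => iK _ s1.
  by rewrite addr0.
have sJ : mass J s = 1.
  apply/eqP; rewrite eq_le (singular_mass S Js KH _ Ps) ?pi_sharp_center// andbT -s1.
  by apply: mass_sub s0; exact: pi_sharp_center.
rewrite sJ subrr addr0 in L1 *.
have D0 : forall k, k \in pi_sharp J L :\: Some @^-1: L -> 0 <= s k.
  by move=> k; rewrite inE => /andP[_]; exact: s0.
have Dge := mass_ge0 D0.
split; last by lra.
apply/negPn/negP => iL; have iD : i \in pi_sharp J L :\: Some @^-1: L by rewrite inE iL.
have : mass [set i] s <= mass (pi_sharp J L :\: Some @^-1: L) s.
  by apply: mass_sub D0; rewrite sub1set.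
by rewrite mass1; lra.
Qed.

(** Hence the least cardinality of a contact set never drops, and a new contact set of the old least
    cardinality is a copy of an old one. *)
Lemma contacts_transform J T' : singular H P J ->
  T' \in contacts (blowup_strata H J) (transform J P) ->
  exists2 T, T \in contacts H P & Some @: T \subset T'.
Proof.
move=> Js; rewrite inE => /asboolP[L Ls <-]; exists (contact P (pi_sharp J L)).
  by rewrite inE; apply/asboolP; exists (pi_sharp J L) => //; exact: (singular_pi S Js Ls).
exact: contact_transform.
Qed.

End Contact.

(** Double induction: contact sets have at least [n + 2 - u] elements, and at most [c] of them have
    exactly that many. Each round lowers [c]; when none is left, [u] decreases. *)
Lemma bounded_resolvable n :
  (forall (I : finType) (H : {set {set I}}) (P : point_family R I) d,
     is_system H P d -> {in H, forall K : {set I}, #|K| <= n}%N -> resolvable H P) ->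
  forall u c (I : finType) (H : {set {set I}}) (P : point_family R I) d,
  is_system H P d -> {in H, forall K : {set I}, #|K| <= n.+1}%N ->
  bounded H P (fun=> 0) 1 ->
  {in contacts H P, forall T : {set I}, n.+2 - u <= #|T|}%N ->
  (#|[set T in contacts H P | #|T| == n.+2 - u]| <= c)%N ->
  resolvable H P.
Proof.
move=> IH; elim=> [|u IHu].
  (* A contact set would need [n + 2] vertices inside a stratum with at most [n + 1]. *)
  move=> c I H P d S Hn PB Tn _; apply: resolvable_nil => K Ks.
  have : (n.+2 <= #|contact P K|)%N.
    by rewrite -[n.+2]subn0; apply: Tn; rewrite inE; apply/asboolP; exists K.
  rewrite leqNgt ltnS (leq_trans _ (Hn _ Ks.1))// subset_leq_card//.
  by apply/subsetP => i; rewrite inE => /andP[].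
set t := (n.+2 - u.+1)%N => c; elim: c => [|c IHc] I H P d S Hn PB Tt Tc.
all: have [/existsP[T /andP[TC /eqP Tt']]|/existsPn noT] :=
  boolP [exists T : {set I}, (T \in contacts H P) && (#|T| == t)]; last first.
all: try by
  apply: (IHu _ _ _ _ _ S Hn PB _ (leqnn _)) => T TC; have := Tt _ TC;
  have := noT T; rewrite TC /t /= => /eqP; lia.
  by move: Tc; rewrite leqn0 cards_eq0 => /eqP/setP/(_ T); rewrite in_set TC Tt' eqxx in_set0.
have [j jT] : exists j, j \in T.
  apply/set0Pn; move: TC; rewrite inE => /asboolP[K Ks <-].
  exact: contact_neq0 PB Ks.
have jH : [set j] \in H.
  move: TC jT; rewrite inE => /asboolP[K Ks <-]; rewrite inE => /andP[jK _].
  by apply: sys_down S _ _ Ks.1 _; rewrite sub1set.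
(* Only contact sets avoiding [j] are counted: those through [j] vanish once no singular stratum
   contains [j]. *)
pose Q (I' : finType) (H' : {set {set I'}}) (P' : point_family R I') (j' : I') :=
  [/\ is_system H' P' d, {in H', forall K : {set I'}, #|K| <= n.+1}%N,
      bounded H' P' (fun=> 0) 1, {in contacts H' P', forall T : {set I'}, t <= #|T|}%N
    & (#|[set T in contacts H' P' | (#|T| == t) && (j' \notin T)]| <= c)%N].
have Qend I' H' P' j' : Q I' H' P' j' -> (forall K, singular H' P' K -> j' \notin K) ->
    resolvable H' P'.
  move=> [S' Hn' B' t' c'] noj; apply: IHc S' Hn' B' t' _; apply: leq_trans c'.
  apply: subset_leq_card; apply/subsetP => T'; rewrite !inE => /andP[/asboolP TC' ->].
  rewrite andTb; apply/andP; split; first exact/asboolP.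
  have [K Ks <-] := TC'; rewrite inE; apply/negP => /andP[jK _].
  by have := noj _ Ks; rewrite jK.
have Qstep I' H' P' j' J : Q I' H' P' j' -> singular H' P' J ->
    Q _ (blowup_strata H' J) (transform J P') (Some j').
  move=> [S' Hn' B' t' c'] Js; split.
  - exact: transform_system.
  - by move=> L; exact: card_blowup_strata.
  - exact: bounded0_1 S' Js B'.
  - move=> T' /(contacts_transform S' Js)[T0 /t' T0t /subset_leq_card].
    by rewrite card_imset; [exact: leq_trans|exact: Some_inj].
  apply: leq_trans c'.
  rewrite -[X in (_ <= X)%N](card_imset _ (imset_inj (@Some_inj _))).
  apply/subset_leq_card/subsetP => T'; rewrite inE => /and3P[TC' /eqP T't jT'].
  have [T0 T0C T0T'] := contacts_transform S' Js TC'.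
  (* [T0] has at least [t] elements and [T'] exactly [t], so the inclusion is an equality. *)
  have T'E : Some @: T0 = T'.
    by apply/eqP; rewrite eqEcard T0T' T't card_imset ?t'//; exact: Some_inj.
  rewrite -T'E; apply: imset_f; rewrite inE T0C/=.
  rewrite -T'E mem_imset in jT'; last exact: Some_inj.
  by rewrite jT' andbT -T't -T'E card_imset//; exact: Some_inj.
have Qj : Q _ H P j.
  split=> //; rewrite -ltnS; apply: leq_trans Tc; apply: proper_card.
  apply/properP; split.
    by apply/subsetP => T'; rewrite !inE => /and3P[-> -> _].
  by exists T; rewrite !inE ?jT ?andbF//; move: TC; rewrite inE Tt' eqxx andbT.
(* If [[set j]] is singular, no point has [s j < 1] there and the link carries no points; but
   blowing up [[set j]] removes [j] from every stratum. *)
have [js|js] := pselect (singular H P [set j]).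
  apply: (resolvable_step js); apply: (Qend _ _ _ _ (Qstep _ _ _ _ _ Qj js)) => L [LH _].
  move: LH; rewrite in_blowup_strata => /andP[_].
  by rewrite sub1set inE.
have js' : exists2 s, P [set j] s & s j < 1.
  apply: contrapT => ns; apply: js; split=> // s Ps; rewrite mass1 leNgt.
  by apply/negP => sj; apply: ns; exists s.
apply: (link_resolvable (Q := Q) _ Qstep Qend _ Qj erefl (fun _ _ _ => iff_refl _)).
  by move=> ? ? ? ? [S' *]; exists d.
apply: IH (link_system S js') _ => K; rewrite inE => /andP[jK /Hn].
by rewrite cardsU1 jK.
Qed.

Lemma system_resolvable n (I : finType) (H : {set {set I}}) (P : point_family R I) d :
  is_system H P d -> {in H, forall K : {set I}, #|K| <= n}%N -> resolvable H P.
Proof.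
elim: n I H P d => [|n IH] I H P d S Hn.
  apply: resolvable_nil => K [KH K1]; have [s Ps] := sys_ne S KH.
  have := K1 _ Ps; move: (Hn _ KH); rewrite leqn0 cards_eq0 => /eqP ->.
  by rewrite mass_eq0 ?ler10// => i; rewrite inE.
apply: (resolvable_from_bounded _ S Hn) => {I H P d S Hn} I H P d S Hn B.
(* With [u = n + 2] the lower bound on contact sets is 0, hence vacuous. *)
apply: (bounded_resolvable IH (u := n.+2) S Hn B _ (leqnn _)) => T _.
by rewrite subnn.
Qed.
End MaximalContact.

(** * Passage between polyhedra systems and point families *)

Section Polyhedra.
Context (R : realType).

Local Notation image P f := (@classical_sets.image _ _ P f).

Section Hull.
Context (I : finType) (K : {set I}).

(** A half-space with non-negative normal is convex and absorbs the orthant. *)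
Lemma polyhull_mass_ge (A : coord_space R K -> Prop) (w : I -> R) c :
  {in K, forall i, 0 <= w i} ->
  (forall a, A a -> c <= mass K (fun i => coeff a i * w i)) ->
  forall x, polyhull A x -> c <= mass K (fun i => coeff x i * w i).
Proof.
move=> w0 Ac; apply: convex_hull_sub.
  move=> x y l; rewrite !classical_sets.inE/= => xc yc.
  rewrite /convex.conv/= /unstable.onem /mass.
  have -> : \sum_(i in K) coeff (l%:num *: x + (1 - l%:num) *: y) i * w i =
      l%:num * mass K (fun i => coeff x i * w i) +
      (1 - l%:num) * mass K (fun i => coeff y i * w i).
    rewrite /mass !mulr_sumr -big_split/=; apply: eq_bigr => i _.
    by rewrite coeffD !coeffZ; ring.
  rewrite -[c]mul1r -[X in X * c](subrKC l%:num) mulrDl.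
  by rewrite lerD// ler_wpM2l// subr_ge0.
move=> _ [a Aa [o o0 <-]] /=; apply: le_trans (Ac _ Aa) _.
apply: mass_le => i iK; rewrite coeffD mulrDl lerDl mulr_ge0 ?w0//.
exact: o0.
Qed.

Lemma weight_vec (s : I -> R) : weight (vec K s) = mass K s.
Proof. by apply: eq_bigr => i iK; rewrite coeff_vec iK. Qed.

End Hull.

(** Singularity can be read on generators, and [transform] carries generators to generators, so
    hulls need not be followed through blow-ups. *)
Definition generates (D : polyhedra_system R) (P : point_family R (vertices (fabric D))) :=
  forall K, K \in strata (fabric D) -> polyhedron D K = polyhull (image (P K) (vec K)).

Section Generates.
Context (D : polyhedra_system R) (P : point_family R (vertices (fabric D))).
Context (DP : generates P).

Lemma Sing_singular K : K \in Sing D <-> singular (strata (fabric D)) P K.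
Proof.
split=> [KS|[KH K1]].
  have KH := Sing_strata KS; split=> // s Ps.
  have [_ /(_ (vec K s))] := deltaP (denom_gt0 D) (polyhedron_char KH) (Sing_neq0 KS).
  rewrite weight_vec => H; move: KS; rewrite inE => /andP[_ /le_trans]; apply.
  by apply: H; rewrite DP//; apply: sub_polyhull; exists s.
have w1 x : polyhedron D K x -> 1 <= weight x.
  by rewrite DP//; apply: polyhull_weight => _ [s Ps <-]; rewrite weight_vec; exact: K1.
(* On the empty stratum every mass is 0, in accordance with the convention [delta = -1]. *)
have K0 : K != set0.
  apply/eqP => K0; have [[x /w1]] := polyhedron_char KH.
  rewrite /weight big1 ?ler10// => i iK; exfalso; move: iK.
  by rewrite K0 inE.
rewrite inE KH/=.
by have [[x /w1 + <-] _] := deltaP (denom_gt0 D) (polyhedron_char KH) K0.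
Qed.

Lemma generates_transform J (JS : J \in Sing D) :
  @generates (char_transform JS) (transform J P).
Proof.
move=> L LH; rewrite [LHS]/(transform_polyhedron (polyhedron D) J L).
have KH := pi_sharp_strata LH; have LK := pi_sharp_sup J L.
rewrite /transform_polyhedron; have [nL|nL] := boolP (None \in L).
  have JK := pi_sharp_center J nL.
  rewrite DP// polyhull_image_hull; last 2 first.
  - exact: lambda_linear.
  - exact: lambda_orthant.
  rewrite polyhull_translate; congr polyhull.
  have E s : lambda_map J L (vec (pi_sharp J L) s) - e_inf R L = vec L (blow J s).
    apply: coeffP => -[i|] iL; rewrite coeffD coeffN !coeff_vec iL/= ?subr0.
      by rewrite (subsetP LK) ?inE.
    by congr (_ - _); apply: eq_bigr => i iJ; rewrite coeff_vec (subsetP JK).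
  apply/classical_sets.seteqP; split.
    by move=> _ [_ [_ [s Ps <-] <-] <-]; exists (blow J s); [exists s|rewrite E].
  move=> _ [_ [s Ps ->] <-]; rewrite -E; eexists; last reflexivity.
  by eexists; last reflexivity; exists s.
have pE : pi_sharp J L = Some @^-1: L by rewrite /pi_sharp (negbTE nL).
have E s : relabel L (vec (Some @^-1: L) s) = vec L (blow J s).
  apply: coeffP => -[i|] iL; last by rewrite iL in nL.
  by rewrite !coeff_vec iL inE iL.
rewrite DP// pE polyhull_relabel//; congr polyhull.
apply/classical_sets.seteqP; split.
  move=> _ [_ [s Ps <-] <-]; exists (blow J s); last by rewrite E.
  by exists s => //; rewrite pE.
move=> _ [_ [s + ->] <-]; rewrite pE => Ps; rewrite -E.
by eexists; last reflexivity; exists s.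
Qed.

End Generates.

Definition points (D : polyhedra_system R) : point_family R (vertices (fabric D)) :=
  fun K s => exists2 x, polyhedron D K x & s = coeff x.

Lemma points_generates (D : polyhedra_system R) : generates (@points D).
Proof.
move=> K KH; rewrite -[LHS](char_polyhullK (polyhedron_char KH)); congr polyhull.
have E x : vec K (coeff x) = x.
  by apply: coeffP => i iK; rewrite coeff_vec iK.
apply/classical_sets.seteqP; split=> [x Px|_ [_ [x Px ->] <-]].
  by exists (coeff x); [exists x|exact: E].
by rewrite E.
Qed.

(** A form with natural coefficients takes lattice values on the generating set [A], so it has a
    minimum there, which bounds it on the whole hull. *)
Lemma points_system (D : polyhedra_system R) :
  is_system (strata (fabric D)) (@points D) (denom D).
Proof.
have d0 := denom_gt0 D; split=> //.
- by move=> J K KH; exact: strata_down.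
- by move=> K /polyhedron_char[[x Dx] _]; exists (coeff x), x.
- move=> K s KH [x Dx ->] i iK; have [_ [A Ad DA]] := polyhedron_char KH.
  have w0 : {in K, forall k, 0 <= (k == i)%:R :> R} by [].
  have E (y : coord_space R K) : mass K (fun k => coeff y k * (k == i)%:R) = coeff y i.
    rewrite /mass (bigD1 i)//= eqxx mulr1 big1 ?addr0// => k /andP[_ /negbTE ->].
    by rewrite mulr0.
  rewrite -E; rewrite DA in Dx; apply: polyhull_mass_ge w0 _ _ Dx => a /Ad ad.
  by rewrite E; have [n ->] := ad i iK; rewrite divr_ge0.
- move=> J K s KH JK [x Dx ->]; have JH := strata_down KH JK.
  exists (coeff (restr J x)); last by move=> i iJ; rewrite coeff_restr iJ.
  by exists (restr J x) => //; rewrite (polyhedron_restr JH KH JK); exists x.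
- move=> J K t KH JK [y + ->]; have JH := strata_down KH JK.
  rewrite (polyhedron_restr JH KH JK) => -[x Dx <-].
  by exists (coeff x); [exists x|move=> i iJ; rewrite coeff_restr iJ].
move=> K s w KH [x Dx ->]; have [_ [A Ad DA]] := polyhedron_char KH.
pose f (y : coord_space R K) := mass K (fun i => coeff y i * (w i)%:R).
have w0 : {in K, forall k, 0 <= (w k)%:R :> R} by [].
have fA a : A a -> lattice (denom D) (f a).
  move=> /Ad ad; apply: lattice_mass => i /ad[n ->].
  by exists (n * w i)%N; rewrite natrM mulrAC.
have Dge c : (forall a, A a -> c <= f a) -> c <= f x.
  by move=> Ac; rewrite DA in Dx; exact: polyhull_mass_ge w0 Ac _ Dx.
have ex : exists n, `[< exists2 a, A a & f a = n%:R / (denom D)%:R >].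
  (* If [A] were empty, [f x + 1] would be a vacuous lower bound on [A], hence a bound at [x]. *)
  apply: contrapT => noA; have : f x + 1 <= f x.
    by apply: Dge => a Aa; case: noA; have [n an] := fA a Aa; exists n; apply/asboolP; exists a.
  by rewrite gerDl ler10.
case: (ex_minnP ex) => n /asboolP[a Aa an] nmin.
exists (coeff a); first by exists a => //; rewrite DA; exact: sub_polyhull.
split=> [i iK|]; first exact: Ad.
rewrite -/(f a) -/(f x) an; apply: Dge => b Ab; have [k bk] := fA b Ab.
rewrite bk ler_pM2r ?invr_gt0 ?ltr0n// ler_nat; apply: nmin.
by apply/asboolP; exists b.
Qed.

Definition resolution (D : polyhedra_system R) : Prop :=
  exists (k : nat) (Ds : nat -> polyhedra_system R),
    [/\ Ds 0%N = D,
        (forall i : nat, (i < k)%N ->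
           exists (J : {set vertices (fabric (Ds i))}) (JS : J \in Sing (Ds i)),
             Ds i.+1 = char_transform JS)
      & Sing (Ds k) = set0].

Lemma resolution_step (D : polyhedra_system R) (J : {set vertices (fabric D)})
    (JS : J \in Sing D) : resolution (char_transform JS) -> resolution D.
Proof.
move=> [k [Ds [D0 Dstep Dk]]].
exists k.+1, (fun i => if i is i'.+1 then Ds i' else D); split=> //.
by move=> [_|i /Dstep//]; exists J, JS.
Qed.

(** The fields of the system are separate arguments so that the index type and the strata are free
    for the induction on [resolvable]. *)
Lemma resolvable_resolution (I : finType) (H : {set {set I}}) (P : point_family R I) :
  resolvable H P ->
  forall down d poly d0 char restr,
  let D := @PolyhedraSystem R (@SupportFabric I H down) d poly d0 char restr in
  @generates D P -> resolution D.
Proof.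
elim=> {I H P} [I H P noS|I H P J Js _ IH] down d poly d0 char restr D DP.
  exists 0%N, (fun=> D); split=> //; apply/setP => K; rewrite in_set0.
  by apply/negP => /(Sing_singular DP)/noS.
have JS : J \in Sing D by apply/(Sing_singular DP).
by apply: (resolution_step (JS := JS)); apply: IH; exact: (generates_transform DP (JS := JS)).
Qed.

End Polyhedra.

Theorem theorem2 (R : realType) (D : polyhedra_system R) :
  exists (k : nat) (Ds : nat -> polyhedra_system R),
    [/\ Ds 0%N = D,
        (forall i : nat, (i < k)%N ->
           exists (J : {set vertices (fabric (Ds i))}) (JS : J \in Sing (Ds i)),
             Ds i.+1 = char_transform JS)
      & Sing (Ds k) = set0].
Proof.
have S := points_system D; have G := @points_generates _ D.
have {S} res := system_resolvable S (fun K _ => max_card (mem K)).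
case: D res G => -[I H down] d poly d0 char restr res G.
exact: (resolvable_resolution res G).
Qed.
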